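(* Let $g_0$ be a Riemannian metric on $M$, $Y$ a vector field on $M$ and $\lambda\in\mathbb{R}$ such that $$-2\,\mathrm{Ric}^*(g_0)=\pounds_Y g_0-2\lambda g_0 .$$ Set $g(t)=g_0$ and $\sigma(t)=1-2\lambda t$, and integrate the $t$-dependent vector field $X(t)=\frac{1}{\sigma(t)}Y$ to give a family of diffeomorphisms $\psi_t$ with $\psi_0$ the identity. Then $\bar g(t)=\sigma(t)\,\psi_t^*(g(t))=\sigma(t)\,\psi_t^*(g_0)$ is a $*$-Ricci flow with $\bar g(0)=g_0$: $$\frac{\partial\bar g}{\partial t}=\sigma'(t)\psi_t^*(g_0)+\sigma(t)\psi_t^*(\pounds_X g_0)=\psi_t^*(-2\lambda g_0+\pounds_Y g_0)=\psi_t^*(-2\,\mathrm{Ric}^*(g_0))=-2\,\mathrm{Ric}^*(\bar g).$$ (Thus a $*$-Ricci soliton is a self-similar solution of the $*$-Ricci flow.)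
   Context: On an almost contact manifold $M$ with structure tensor $\phi$ and Riemannian metric $g$ with curvature tensor $R$, the $*$-Ricci tensor $\mathrm{Ric}^*(g)=S^*$ is $S^*(X,Y)=\frac12\,\mathrm{trace}(Z\mapsto R(X,\phi Y)\phi Z)$ for vector fields $X,Y$ on $M$. The $*$-Ricci flow is the evolution equation $\frac{\partial g}{\partial t}=-2S^*$. A metric $g$ is called a $*$-Ricci soliton if there exist a constant $\mu$ and a vector field $V$ with $\pounds_V g+2S^*+2\mu g=0$ (the hypothesis of the claim is this equation with $V=Y$, $\mu=-\lambda$). $\pounds$ denotes the Lie derivative and $\psi_t^*$ denotes pullback by $\psi_t$.
   Formalization: As the claim fails for fixed φ, the last equality and the *-Ricci flow claim use Ric* of the structure tensor ψ_t^*φ; for fixed φ they are stated when every ψ_t preserves φ. The smooth family ψ_t is taken as given on an open interval around 0 where σ>0. *)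

(* Defs.v *)
From HB Require Import structures.
From mathcomp Require Import all_boot all_order all_algebra.
From mathcomp Require Import all_classical all_reals all_analysis.
Import Order.TTheory GRing.Theory Num.Theory.
Import numFieldNormedType.Exports.

Set Implicit Arguments.
Unset Strict Implicit.
Unset Printing Implicit Defensive.

Local Open Scope classical_set_scope.
Local Open Scope ring_scope.

(* Vectors are rows and linear maps act on the right: the matrix A stands for
   v |-> v *m A, a bilinear form B for (u, v) |-> u *m B *m v^T, and 'J f x is
   the matrix of the differential of f at x. *)

(* The notion is meant for an open set U and finite-dimensional V and W, where
   it is the usual one: all the iterated directional derivatives exist in the
   Frechet sense. *)
Fixpoint Ck (R : realType) (V W : normedModType R) (k : nat) (U : set V)
    (f : V -> W) : Prop :=
  if k is k'.+1 then
    (forall x, U x -> differentiable f x) /\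
    (forall v : V, Ck k' U (fun x => 'D_v f x))
  else forall x, U x -> {for x, continuous f}.

Definition smooth_on (R : realType) (V W : normedModType R) (U : set V)
    (f : V -> W) : Prop := forall k, Ck k U f.

Record chart (R : realType) (n : nat) (T : topologicalType) := Chart {
  source : set T;
  target : set 'rV[R]_n;
  coord : T -> 'rV[R]_n;
  param : 'rV[R]_n -> T;
  source_open : open source;
  target_open : open target;
  coord_target : forall p, source p -> target (coord p);
  param_source : forall x, target x -> source (param x);
  coordK : forall p, source p -> param (coord p) = p;
  paramK : forall x, target x -> coord (param x) = x;
  coord_continuous : forall p, source p -> {for p, continuous coord};
  param_continuous : forall x, target x -> {for x, continuous param} }.

(* [chart_at] selects a chart of the atlas around each point.  Its only role is
   to identify the tangent space at p with R^n, through the coordinate basis of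
   [chart_at p]. *)
Record manifold (R : realType) (n : nat) := Manifold {
  mcarrier :> topologicalType;
  atlas : set (chart R n mcarrier);
  chart_at : mcarrier -> chart R n mcarrier;
  chart_at_atlas : forall p, atlas (chart_at p);
  chart_at_source : forall p, source (chart_at p) p;
  atlas_smooth : forall c d, atlas c -> atlas d ->
    smooth_on [set x | target c x /\ source d (param c x)]
              (coord d \o param c);
  manifold_hausdorff : hausdorff_space mcarrier;
  manifold_second_countable : @second_countable mcarrier }.

Section Fields.
Context {R : realType} {n : nat} (M : manifold R n).

Definition vector_field : Type := M -> 'rV[R]_n.
Definition one_form : Type := M -> 'cV[R]_n.
Definition endo_field : Type := M -> 'M[R]_n.
Definition bilin_field : Type := M -> 'M[R]_n.

End Fields.

Section Geometry.
Context {R : realType} {n : nat} {M : manifold R n}.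
Implicit Types (p : M) (c d : chart R n M) (x : 'rV[R]_n).
Implicit Types (X Y xi : vector_field M) (eta : one_form M).
Implicit Types (phi : endo_field M) (g b : bilin_field M).

Definition to_chart c p : 'M[R]_n :=
  'J (coord c \o param (chart_at p)) (coord (chart_at p) p).

Definition from_chart c p : 'M[R]_n :=
  'J (coord (chart_at p) \o param c) (coord c p).

Definition vector_in c X x : 'rV[R]_n :=
  X (param c x) *m to_chart c (param c x).
Definition form_in c eta x : 'cV[R]_n :=
  from_chart c (param c x) *m eta (param c x).
Definition endo_in c phi x : 'M[R]_n :=
  from_chart c (param c x) *m phi (param c x) *m to_chart c (param c x).
Definition bilin_in c b x : 'M[R]_n :=
  from_chart c (param c x) *m b (param c x) *m (from_chart c (param c x))^T.

Definition smooth_vector X :=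
  forall c, atlas c -> smooth_on (target c) (vector_in c X).
Definition smooth_form eta :=
  forall c, atlas c -> smooth_on (target c) (form_in c eta).
Definition smooth_endo phi :=
  forall c, atlas c -> smooth_on (target c) (endo_in c phi).
Definition smooth_bilin b :=
  forall c, atlas c -> smooth_on (target c) (bilin_in c b).

(* phi^2 = - id + eta (x) xi and eta(xi) = 1; on a nonempty manifold this
   forces n to be odd. *)
Definition almost_contact phi xi eta :=
  [/\ smooth_endo phi, smooth_vector xi, smooth_form eta,
      forall p, phi p *m phi p = - 1%:M + eta p *m xi p
    & forall p, xi p *m eta p = 1%:M].

Definition riemannian_metric g :=
  [/\ smooth_bilin g, forall p, (g p)^T = g p
    & forall p (v : 'rV[R]_n), v != 0 -> 0 < (v *m g p *m v^T) 0 0].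

Definition partial (i : 'I_n) (f : 'rV[R]_n -> R) x : R :=
  'D_(delta_mx 0 i) f x.

Implicit Types (G : 'rV[R]_n -> 'M[R]_n).

(* The coefficient of the k-th coordinate field in nabla_{d_i} d_j. *)
Definition christoffel G (i j k : 'I_n) x : R :=
  2^-1 * \sum_(l < n) (invmx (G x)) k l *
    (partial i (fun y => G y j l) x + partial j (fun y => G y i l) x
     - partial l (fun y => G y i j) x).

(* The coefficient of the l-th coordinate field in R(d_i, d_j) d_k, where
   R(X, Y) Z = nabla_X nabla_Y Z - nabla_Y nabla_X Z - nabla_[X,Y] Z. *)
Definition riemann G (i j k l : 'I_n) x : R :=
  partial i (christoffel G j k l) x - partial j (christoffel G i k l) x
  + \sum_(m < n) (christoffel G j k m x * christoffel G i m l x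
                  - christoffel G i k m x * christoffel G j m l x).

(* z |-> R(u, w) z on the tangent space at p.  The components are taken in
   [chart_at p], whose coordinate basis is the one used at p. *)
Definition curvature g p (u w : 'rV[R]_n) : 'M[R]_n :=
  \matrix_(k, l) \sum_(i < n) \sum_(j < n) u 0 i * w 0 j *
    riemann (bilin_in (chart_at p) g) i j k l (coord (chart_at p) p).

(* S*(u, v) = 1/2 trace (z |-> R(u, phi v) (phi z)). *)
Definition star_ricci phi g : bilin_field M := fun p =>
  \matrix_(i, j) (2^-1 *
    \tr (phi p *m curvature g p (delta_mx 0 i) (delta_mx 0 j *m phi p))).

(* (L_Y b)_ij = Y^k d_k b_ij + (d_i Y^k) b_kj + b_ik (d_j Y^k). *)
Definition lie_derivative Y b : bilin_field M := fun p =>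
  let c := chart_at p in
  let x := coord c p in
  'D_(Y p) (bilin_in c b) x
  + 'J (vector_in c Y) x *m b p + b p *m ('J (vector_in c Y) x)^T.

Definition smooth_map (f : M -> M) :=
  continuous f /\
  forall c d, atlas c -> atlas d ->
    smooth_on [set x | target c x /\ source d (f (param c x))]
              (fun x => coord d (f (param c x))).

Definition diffeomorphism (f : M -> M) :=
  exists h : M -> M,
    [/\ cancel f h, cancel h f, smooth_map f & smooth_map h].

Definition tangent_map (f : M -> M) p : 'M[R]_n :=
  'J (coord (chart_at (f p)) \o f \o param (chart_at p))
     (coord (chart_at p) p).

Definition pullback_bilin (f : M -> M) b : bilin_field M := fun p =>
  tangent_map f p *m b (f p) *m (tangent_map f p)^T.

(* v |-> df^-1 (phi (df v)), for a diffeomorphism f. *)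
Definition pullback_endo (f : M -> M) phi : endo_field M := fun p =>
  tangent_map f p *m phi (f p) *m invmx (tangent_map f p).

Implicit Types (J : set R) (psi : R -> M -> M).

Definition smooth_family J psi :=
  (forall t p, J t ->
    {for (t, p), continuous (fun tp : R * M => psi tp.1 tp.2)}) /\
  forall c d, atlas c -> atlas d ->
    smooth_on
      [set tx : R * 'rV[R]_n |
        [/\ J tx.1, target c tx.2 & source d (psi tx.1 (param c tx.2))]]
      (fun tx : R * 'rV[R]_n => coord d (psi tx.1 (param c tx.2))).

(* psi_t is the family of diffeomorphisms, defined for t in J and starting at
   the identity, obtained by integrating the time-dependent field X. *)
Definition flow_of J (X : R -> vector_field M) psi :=
  [/\ forall p, psi 0 p = p,
      forall t, J t -> diffeomorphism (psi t),
      smooth_family J psi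
    & forall t p, J t ->
        is_derive t 1 (fun s => coord (chart_at (psi t p)) (psi s p))
                  (X t (psi t p))].

(* d/dt g(t) = -2 S*(g(t)) on J, where S* is taken with respect to a structure
   tensor phi(t).  The usual flow is the case of a constant phi; the general
   case is needed because S* is natural only if phi is transported as well:
   for a diffeomorphism f, f^* S*(phi, g) = S*(f^* phi, f^* g). *)
Definition star_ricci_flow J (phi : R -> endo_field M)
    (g : R -> bilin_field M) :=
  forall t, J t -> riemannian_metric (g t) /\
    forall p, is_derive t 1 (fun s => g s p)
                        (- 2 *: star_ricci (phi t) (g t) p).

Definition sigma (lambda t : R) : R := 1 - 2 * lambda * t.

Definition gbar (lambda : R) psi (g0 : bilin_field M) (t : R) :
    bilin_field M :=
  fun p => sigma lambda t *: pullback_bilin (psi t) g0 p.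

End Geometry.

(* Main.v *)
(** In charts around p and psi_t(p), write F_s for psi_s.  The pullback
    psi_s^* g is A_s (g o F_s) A_s^T with A_s the Jacobian matrix of F_s.
    Equality of mixed partial derivatives of F in (s, x) turns d/ds F_s = X(F_s)
    into d/ds A_s = A_s 'J X(F_s), so the product rule gives
    d/ds psi_s^* g = psi_s^* (L_X g); with X = Y / sigma the soliton equation
    reduces the derivative of sigma psi^* g_0 to psi^* (- 2 Ric^*(g_0)).

    It remains to see that Ric^* is natural and invariant under scaling the
    metric by a constant.  For H = a A (G o F) A^T, Koszul's formula gives the
    gauge law Gamma'_i A = d_i A + A sum_b A_ib Gamma_b(F) for the connection
    matrices; differentiating it once more and antisymmetrising,
    R'_ij A = A sum_bc A_ib A_jc R_bc(F), and the trace defining Ric^* absorbs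
    the conjugation by A. *)

Require Import Defs.
From mathcomp Require Import all_boot all_order all_algebra.
From mathcomp Require Import perm ring.
From mathcomp Require Import all_classical all_reals all_analysis.
Import Order.TTheory GRing.Theory Num.Theory.
Import numFieldNormedType.Exports.
Set Implicit Arguments.
Unset Strict Implicit.
Unset Printing Implicit Defensive.
Local Open Scope classical_set_scope.
Local Open Scope ring_scope.

(** * Maps of class C^k *)

Section DiffLocal.
Context {R : realType} {V W : normedModType R}.
Implicit Types (f g : V -> W) (U : set V).

(** The tangent space at p is R^n through [chart_at p], and [chart_at] need not vary continuously.
    Hence [tangent_map (psi s) p] may jump as s varies, and neither it nor the matrix of g at
    psi_s(p) can be differentiated as it stands. Derivatives are therefore taken in charts fixed in
    advance, after rewriting the pullback by [bilin_in_pullback]; the result is read back in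
    [chart_at] at the single point of interest, where the change of basis is the identity. The
    choice of sigma and X is dictated by cancellation: sigma' = - 2 lambda is the coefficient of g_0
    in the soliton equation, and the factor 1 / sigma in X undoes the factor sigma in front of the
    pullback. Equality of mixed derivatives enters for the second derivatives of F, for those of A,
    and in time and space along the flow. The last use lives on R x R^n, so the symmetry is proved
    over an arbitrary normed space. *)

Lemma near_eq_differentiable f g x :
  (\near x, f x = g x) -> differentiable f x -> differentiable g x.
Proof.
move=> fg df.
(* The first-order expansion of f at x is also one of g; uniqueness of the differential then yields
   differentiability of g. *)
have gE : g \o shift x = cst (g x) + 'd f x +o_ (0 : V) id.
  have := diff_locally df; rewrite -(nbhs_singleton fg).
  move=> /eqaddoP fo; apply/eqaddoP => e e0; have := fo e e0.
  move: fg; rewrite (near_shift 0) subr0 => fg.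
  move=> fo'; move: fo' fg; apply: filterS2 => h /=; rewrite !fctE /= => + fgh.
  by rewrite fgh.
have dc : continuous ('d f x) by exact: diff_continuous.
apply/diff_locallyP; rewrite (diff_unique dc gE); split => //.
Qed.

End DiffLocal.

Section CkBasic.
Context {R : realType} {V W : normedModType R}.
Implicit Types (f g : V -> W) (U : set V) (k : nat).

Lemma CkW k U f : Ck k.+1 U f -> Ck k U f.
Proof.
elim: k f => [|k IH] f [df Df] /=.
  by move=> x Ux; apply/differentiable_continuous/df.
by split => // v; exact: IH.
Qed.

(** Every clause of [Ck] is a statement at one point about f near it, so a set N containing that
    point carries all the information. This allows the target chart to depend on the point when a
    pulled-back metric is shown smooth. *)
Lemma Ck_local k U f :
  (forall x, U x -> exists2 N : set V, N x & Ck k N f) -> Ck k U f.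
Proof.
elim: k f => [|k IH] f loc.
  by move=> x /loc[N Nx cf]; exact: cf.
split=> [x /loc[N Nx [df _]]|v]; first exact: df.
by apply: IH => x /loc[N Nx [_ Df]]; exists N => //; exact: Df.
Qed.

Lemma Ck_congr k U f g : open U -> {in U, f =1 g} -> Ck k U f -> Ck k U g.
Proof.
move=> oU; have near_U (h h' : V -> W) x : {in U, h =1 h'} -> U x ->
    \near x, h x = h' x.
  move=> hh' Ux; near=> y; apply: hh'; rewrite inE; near: y.
  exact: open_nbhs_nbhs.
elim: k f g => [|k IH] f g fg.
  move=> cf x Ux; suff: g @ x --> g x by [].
  rewrite -(fg x (mem_set Ux)); apply: cvg_trans (cf x Ux).
  by apply: near_eq_cvg; apply: near_U => // y yU; rewrite fg.
move=> [df Df]; split=> [x Ux|v].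
  by apply: near_eq_differentiable (df _ Ux); exact: near_U.
apply: IH (Df v) => x; rewrite inE => Ux.
by apply: near_eq_derive; exact: near_U.
Unshelve. all: by end_near. Qed.

Lemma Ck_cst k U (a : W) : Ck k U (cst a).
Proof.
elim: k a => [|k IH] a; first by move=> x _; exact: cst_continuous.
split=> [x _|v]; first exact: differentiable_cst.
rewrite (_ : (fun x => _) = cst 0); first exact: IH.
by apply/funext => x; rewrite derive_cst.
Qed.

Lemma CkD k U f g : open U -> Ck k U f -> Ck k U g -> Ck k U (f + g).
Proof.
move=> oU; elim: k f g => [|k IH] f g.
  by move=> cf cg x Ux; apply: continuousD; [exact: cf|exact: cg].
move=> [df Df] [dg Dg]; split=> [x Ux|v].
  by apply: differentiableD; [exact: df|exact: dg].
apply: (Ck_congr oU _ (IH _ _ (Df v) (Dg v))) => x; rewrite inE => Ux /=.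
by rewrite deriveD //; apply: diff_derivable; [exact: df|exact: dg].
Qed.

Lemma Ck_sum (I : Type) (r : seq I) (P : pred I) (f : I -> V -> W) k U :
  open U -> (forall i, P i -> Ck k U (f i)) ->
  Ck k U (fun x => \sum_(i <- r | P i) f i x).
Proof.
move=> oU cf.
rewrite (_ : (fun x => _) = \sum_(i <- r | P i) f i); last first.
  by apply/funext => x; rewrite fct_sumE.
by elim/big_ind : _ => [|? ? ? ?|//]; [exact: Ck_cst|exact: CkD].
Qed.

End CkBasic.

Section CkReal.
Context {R : realType} {V : normedModType R}.
Implicit Types (f g : V -> R) (U : set V) (k : nat).

Lemma CkM k U f g : open U -> Ck k U f -> Ck k U g ->
  Ck k U (fun x => f x * g x).
Proof.
move=> oU; elim: k f g => [|k IH] f g.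
  by move=> cf cg x Ux; apply: continuousM; [exact: cf|exact: cg].
move=> cf cg; have [df Df] := cf; have [dg Dg] := cg; split=> [x Ux|v].
  by apply: differentiableM; [exact: df|exact: dg].
have h := CkD oU (IH _ _ (CkW cf) (Dg v)) (IH _ _ (CkW cg) (Df v)).
apply: (Ck_congr oU _ h) => x; rewrite inE => Ux /=.
by rewrite (@deriveM _ _ f g) //; apply: diff_derivable; [exact: df|exact: dg].
Qed.

End CkReal.

(** * Matrix-valued maps, entry by entry *)

Section Matrices.
Context {R : realType} {V : normedModType R} {m n : nat}.
Implicit Types (f : V -> 'M[R]_(m, n)) (U : set V) (k : nat).

Lemma differentiable_mxP f x :
  differentiable f x <-> forall i j, differentiable (fun y => f y i j) x.
Proof.
split=> [df i j|df].
  apply: (@differentiable_comp _ _ _ _ f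
    (fun N : 'M[R]_(m, n) => N i j : R)) => //.
  exact: differentiable_coord.
rewrite (_ : f = \sum_(i < m) \sum_(j < n) (fun y => f y i j *: delta_mx i j)).
  apply: differentiable_sum => i; apply: differentiable_sum => j.
  exact: differentiableZl.
apply/funext => y; rewrite fct_sumE {1}[f y]matrix_sum_delta.
by apply: eq_bigr => i _; rewrite fct_sumE.
Qed.

Lemma derive_mxE f x v i j : differentiable f x ->
  ('D_v f x) i j = 'D_v (fun y => f y i j) x.
Proof. by move=> df; rewrite derive_mx ?mxE //; exact: diff_derivable. Qed.

Lemma is_derive_mxP f x v (df : 'M[R]_(m, n)) :
  is_derive x v f df <-> forall i j, is_derive x v (fun y => f y i j) (df i j).
Proof.
split=> [[fx <-] i j|h].
  by split; [exact: (derivable_mxP _ _ _).1 fx i j|rewrite derive_mx ?mxE].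
have dx : derivable f x v by apply/derivable_mxP => i j; exact: ex_derive.
split => //; rewrite derive_mx //; apply/matrixP => i j; rewrite mxE.
exact: derive_val.
Qed.

Lemma continuous_mxP f x :
  {for x, continuous f} <-> forall i j, {for x, continuous (fun y => f y i j)}.
Proof.
split=> [cf i j|cf].
  apply: (@continuous_comp _ _ _ f (fun N : 'M[R]_(m, n) => N i j : R)) => //.
  exact: coord_continuous.
move=> A [P nP sPA]; suff: \forall y \near x, forall i j, P i j (f y i j).
  by apply: filterS => y /sPA.
apply: filter_forall => i; apply: filter_forall => j; exact: cf (nP i j).
Qed.

Lemma Ck_mxP k U f : open U ->
  Ck k U f <-> forall i j, Ck k U (fun x => f x i j).
Proof.
move=> oU; elim: k f => [|k IH] f /=.
  split=> [cf i j x Ux|cf x Ux]; first exact: (continuous_mxP _ _).1 (cf _ Ux) i j.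
  by apply/continuous_mxP => i j; exact: cf.
split=> [[df Df] i j|h].
  split=> [x Ux|v]; first exact: (differentiable_mxP _ _).1 (df _ Ux) i j.
  apply: (Ck_congr oU _ ((IH _).1 (Df v) i j)) => x; rewrite inE => Ux.
  by rewrite derive_mxE //; exact: df.
have df x : U x -> differentiable f x.
  by move=> Ux; apply/differentiable_mxP => i j; case: (h i j) => + _; exact.
split => // v; apply/IH => i j.
apply: (Ck_congr oU _ ((h i j).2 v)) => x; rewrite inE => Ux.
by rewrite derive_mxE //; exact: df.
Qed.

End Matrices.

(** * Chain rule and composition *)

Section Composition.
Context {R : realType}.

Lemma differentiable_is_derive (V W : normedModType R) (f : V -> W) x v :
  differentiable f x -> is_derive x v f ('D_v f x).
Proof. by move=> df; exact/derivableP/diff_derivable. Qed.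

Lemma derive_comp (U V W : normedModType R) (f : U -> V) (g : V -> W) x v :
  differentiable f x -> differentiable g (f x) ->
  'D_v (g \o f) x = 'D_('D_v f x) g (f x).
Proof.
move=> df dg; rewrite !deriveE //; last exact: differentiable_comp.
by rewrite diff_comp.
Qed.

Lemma derive_delta_sum (m : nat) (W : normedModType R) (f : 'rV[R]_m -> W) x w :
  differentiable f x ->
  'D_w f x = \sum_(i < m) w 0 i *: 'D_(delta_mx 0 i) f x.
Proof.
move=> df; rewrite deriveE // {1}[w]row_sum_delta linear_sum.
by apply: eq_bigr => i _; rewrite linearZ deriveE.
Qed.

(** By the chain rule D_v (f o F) is a finite sum of products of a coordinate of D_v F with a
    partial derivative of f composed with F, and the induction hypothesis covers the latter. Real
    values make [CkM] applicable to these products. *)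
Lemma Ck_comp_real (V : normedModType R) (m k : nat) (U : set V)
    (U' : set 'rV[R]_m) (F : V -> 'rV[R]_m) (f : 'rV[R]_m -> R) :
  open U -> (forall x, U x -> U' (F x)) ->
  Ck k U F -> Ck k U' f -> Ck k U (f \o F).
Proof.
move=> oU UF; elim: k f => [|k IH] f.
  by move=> cF cf x Ux; apply: continuous_comp; [exact: cF|exact/cf/UF].
move=> cF [df Df]; have [dF DF] := cF; split=> [x Ux|v].
  by apply: differentiable_comp; [exact: dF|exact/df/UF].
have h : Ck k U (fun x => \sum_(i < m)
    ('D_v F x) 0 i * ('D_(delta_mx 0 i) f \o F) x).
  apply: Ck_sum => // i _; apply: CkM => //; first exact: (Ck_mxP _ _ oU).1 (DF v) 0 i.
  exact: IH (CkW cF) (Df _).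
apply: (Ck_congr oU _ h) => x; rewrite inE => Ux.
rewrite (derive_comp _ (dF x Ux) (df _ (UF _ Ux))).
by rewrite derive_delta_sum //; exact/df/UF.
Qed.

Lemma Ck_comp (V : normedModType R) (m p q k : nat) (U : set V)
    (U' : set 'rV[R]_m) (F : V -> 'rV[R]_m) (f : 'rV[R]_m -> 'M[R]_(p, q)) :
  open U -> open U' -> (forall x, U x -> U' (F x)) ->
  Ck k U F -> Ck k U' f -> Ck k U (f \o F).
Proof.
move=> oU oU' UF cF cf; apply/(Ck_mxP _ _ oU) => i j.
exact: (Ck_comp_real oU UF cF ((Ck_mxP _ _ oU').1 cf i j)).
Qed.

End Composition.

Section MatrixProduct.
Context {R : realType} {V : normedModType R} {m n p : nat}.
Implicit Types (f : V -> 'M[R]_(m, n)) (g : V -> 'M[R]_(n, p)).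

Lemma mulmx_fctE f g i j : (fun y => (f y *m g y) i j) =
  \sum_(k < n) ((fun y => f y i k) * (fun y => g y k j)).
Proof. by apply/funext => y; rewrite mxE fct_sumE. Qed.

Lemma is_derive_mulmx f g x v df dg :
  is_derive x v f df -> is_derive x v g dg ->
  is_derive x v (fun y => f y *m g y) (df *m g x + f x *m dg).
Proof.
move=> /is_derive_mxP fx /is_derive_mxP gx; apply/is_derive_mxP => i j.
rewrite mulmx_fctE !mxE -big_split /=; apply: is_derive_sum => k.
have h := @is_deriveM _ _ _ _ _ _ _ _ (fx i k) (gx k j).
apply: (is_derive_eq h).
by rewrite addrC; congr (_ + _); exact: mulrC.
Qed.

Lemma differentiable_mulmx f g x :
  differentiable f x -> differentiable g x ->
  differentiable (fun y => f y *m g y) x.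
Proof.
move=> /differentiable_mxP df /differentiable_mxP dg.
apply/differentiable_mxP => i j; rewrite mulmx_fctE.
by apply: differentiable_sum => k; exact: differentiableM.
Qed.

Lemma Ck_mulmx (U : set V) k f g : open U ->
  Ck k U f -> Ck k U g -> Ck k U (fun y => f y *m g y).
Proof.
move=> oU /(Ck_mxP _ _ oU) cf /(Ck_mxP _ _ oU) cg; apply/(Ck_mxP _ _ oU) => i j.
rewrite (_ : (fun _ => _) = fun y => \sum_(k < n) f y i k * g y k j).
  by apply: Ck_sum => // l _; exact: CkM.
by apply/funext => y; rewrite mxE.
Qed.

End MatrixProduct.

Section Transpose.
Context {R : realType} {V : normedModType R} {m n : nat}.
Implicit Types (f : V -> 'M[R]_(m, n)) (U : set V).

Lemma is_derive_trmx f x v df :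
  is_derive x v f df -> is_derive x v (fun y => (f y)^T) df^T.
Proof.
move=> /is_derive_mxP fx; apply/is_derive_mxP => i j.
rewrite mxE (_ : (fun _ => _) = fun y => f y j i) //.
by apply/funext => y; rewrite mxE.
Qed.

Lemma Ck_trmx U k f : open U -> Ck k U f -> Ck k U (fun y => (f y)^T).
Proof.
move=> oU /(Ck_mxP _ _ oU) cf; apply/(Ck_mxP _ _ oU) => i j.
rewrite (_ : (fun _ => _) = fun y => f y j i) //.
by apply/funext => y; rewrite mxE.
Qed.

Lemma Ck_scale U k f a : open U -> Ck k U f -> Ck k U (fun y => a *: f y).
Proof.
move=> oU /(Ck_mxP _ _ oU) cf; apply/(Ck_mxP _ _ oU) => i j.
rewrite (_ : (fun _ => _) = fun y => cst a y * f y i j).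
  by apply: CkM => //; exact: Ck_cst.
by apply/funext => y; rewrite mxE.
Qed.

End Transpose.

Section Jacobian.
Context {R : realType}.

Lemma jacobianE (m n : nat) (f : 'rV[R]_m -> 'rV[R]_n) x i j :
  differentiable f x -> 'J f x i j = ('D_(delta_mx 0 i) f x) 0 j.
Proof. by move=> df; rewrite deriveE // mxE. Qed.

Lemma mul_row_jacobian (m n : nat) (f : 'rV[R]_m -> 'rV[R]_n) x v :
  differentiable f x -> v *m 'J f x = 'D_v f x.
Proof. by move=> df; rewrite deriveE // /jacobian mul_rV_lin1. Qed.

Lemma jacobian_comp (m n p : nat) (f : 'rV[R]_m -> 'rV[R]_n)
    (g : 'rV[R]_n -> 'rV[R]_p) x :
  differentiable f x -> differentiable g (f x) ->
  'J (g \o f) x = 'J f x *m 'J g (f x).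
Proof.
move=> df dg; have dgf := differentiable_comp df dg.
apply/row_matrixP => i; rewrite !rowE mulmxA (mul_row_jacobian _ df).
by rewrite (mul_row_jacobian _ dg) (mul_row_jacobian _ dgf) derive_comp.
Qed.

Lemma near_eq_jacobian (m n : nat) (f g : 'rV[R]_m -> 'rV[R]_n) x :
  (\near x, f x = g x) -> differentiable f x -> 'J f x = 'J g x.
Proof.
move=> fg df; have dg := near_eq_differentiable fg df.
apply/matrixP => i j; rewrite [LHS](jacobianE _ _ df) [RHS](jacobianE _ _ dg).
by rewrite (near_eq_derive _ fg).
Qed.

Lemma jacobian_id (m : nat) (x : 'rV[R]_m) : 'J id x = 1%:M.
Proof.
apply/row_matrixP => i; rewrite !rowE mulmx1 mul_row_jacobian ?derive_id //.
Qed.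

Lemma jacobianZ (m n : nat) (f : 'rV[R]_m -> 'rV[R]_n) a x :
  differentiable f x -> 'J (fun y => a *: f y) x = a *: 'J f x.
Proof.
move=> df; apply/row_matrixP => i; rewrite !rowE -scalemxAr.
apply: etrans (mul_row_jacobian _ (differentiableZ a df)) _.
apply: etrans (deriveZ a (diff_derivable df)) _.
by apply: congr1; exact/esym/mul_row_jacobian.
Qed.

Lemma Ck_jacobian (m n k : nat) (U : set 'rV[R]_m)
    (f : 'rV[R]_m -> 'rV[R]_n) :
  open U -> Ck k.+1 U f -> Ck k U (fun x => 'J f x).
Proof.
move=> oU [df Df]; apply/(Ck_mxP _ _ oU) => i j.
apply: (Ck_congr oU _ ((Ck_mxP _ _ oU).1 (Df (delta_mx 0 i)) 0 j)) => x.
by rewrite inE => Ux; rewrite jacobianE //; exact: df.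
Qed.

End Jacobian.

(** * Symmetry of second derivatives *)

Section Schwarz.
Context {R : realType} {V : normedModType R}.

Lemma is_derive_line (f : V -> R) (y v : V) (s : R) :
  differentiable f (y + s *: v) ->
  is_derive s 1 (fun t => f (y + t *: v)) ('D_v f (y + s *: v)).
Proof.
move=> df; have dl : is_diff s (fun t : R => y + t *: v) ( *:%R^~ v).
  by apply: is_diff_eq; rewrite add0r.
have dc : differentiable (f \o fun t : R => y + t *: v) s.
  by apply: differentiable_comp.
split; first exact: diff_derivable.
by rewrite !deriveE // diff_comp // diff_val /= scale1r.
Qed.

Lemma MVT_line (f : V -> R) (y v : V) (h : R) : 0 < h ->
  (forall s, 0 <= s <= h -> differentiable f (y + s *: v)) ->
  exists2 s, 0 <= s <= h & f (y + h *: v) - f y = h * 'D_v f (y + s *: v).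
Proof.
move=> h0 df; pose u := fun t : R => f (y + t *: v).
have du s : 0 <= s <= h -> is_derive s 1 u ('D_v f (y + s *: v)).
  by move=> sh; apply: is_derive_line; exact: df.
have [||s sh] := @MVT R u (fun s => 'D_v f (y + s *: v)) 0 h h0.
- by move=> s; rewrite in_itv /= => /andP[s0 sh]; apply: du; rewrite !ltW.
- apply: derivable_within_continuous => s; rewrite in_itv /= => sh.
  by have [] := du s sh.
rewrite /u scale0r addr0 subr0 mulrC => ->; exists s => //.
by move: sh; rewrite in_itv /= => /andP[s0 sh]; rewrite !ltW.
Qed.

(** Divided by h^2, for increments h v and h w, this is the difference quotient that approximates
    both mixed derivatives of f at x. *)
Definition second_difference (f : V -> R) (x v w : V) : R :=
  f (x + v + w) - f (x + v) - (f (x + w) - f x).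

Lemma second_difference_sym (f : V -> R) x v w :
  second_difference f x v w = second_difference f x w v.
Proof. by rewrite /second_difference (addrAC x w v); ring. Qed.

(** Two applications of the mean value theorem: in direction v to z |-> f (z + h w) - f z, then in
    direction w to D_v f. *)
Lemma second_difference_mean (f : V -> R) (U : set V) (x v w : V) (h : R) :
  0 < h -> Ck 2 U f ->
  (forall s r, 0 <= s <= h -> 0 <= r <= h -> U (x + s *: v + r *: w)) ->
  exists s r, [/\ 0 <= s <= h, 0 <= r <= h &
    second_difference f x (h *: v) (h *: w)
    = h ^+ 2 * 'D_w ('D_v f) (x + s *: v + r *: w)].
Proof.
move=> h0 [df Df] xU.
have hh : 0 <= h <= h by rewrite lexx ltW.
have h00 : 0 <= (0 : R) <= h by rewrite lexx ltW.
pose g z := f (z + h *: w) - f z.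
have dshift s : 0 <= s <= h ->
    is_diff (x + s *: v) (fun z => f (z + h *: w))
      ('d f (x + s *: v + h *: w)).
  move=> sh; have dl : is_diff (x + s *: v) (fun z : V => z + h *: w) id.
    by apply: is_diff_eq; rewrite addr0.
  have df' : differentiable f (x + s *: v + h *: w) by apply: df; exact: xU.
  have dc : is_diff (x + s *: v + h *: w) f ('d f (x + s *: v + h *: w)).
    exact: differentiableP.
  exact: is_diff_comp dl dc.
have df0 s : 0 <= s <= h -> differentiable f (x + s *: v).
  by move=> sh; apply: df; rewrite -[_ + _]addr0 -(scale0r w); exact: xU.
have dg s : 0 <= s <= h -> differentiable g (x + s *: v).
  by move=> sh; apply: differentiableB; [case: (dshift s sh)|exact: df0].
have [s sh gE] := MVT_line h0 dg.
have [|r rh dE] := @MVT_line ('D_v f) (x + s *: v) w h h0.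
  by move=> r rh; have [+ _] := Df v; apply; exact: xU.
exists s, r; split => //; rewrite /second_difference -/(g x).
rewrite [x + h *: v + h *: w]lock -lock -/(g (x + h *: v)) gE.
rewrite expr2 -mulrA -dE; congr (_ * _).
have [ds dsE] := dshift s sh.
rewrite deriveB; [|exact: diff_derivable|exact/diff_derivable/df0].
rewrite [X in X - _]deriveE // dsE; congr (_ - _); rewrite deriveE //.
by apply: df; exact: xU.
Qed.

(** The same second difference is h^2 times one mixed derivative at one nearby point and h^2 times
    the other at another. The two values agree, and by continuity each is within e / 2 of its value
    at x. *)
Lemma derive_comm_real (f : V -> R) (U : set V) (x v w : V) :
  open U -> U x -> Ck 2 U f -> 'D_w ('D_v f) x = 'D_v ('D_w f) x.
Proof.
move=> oU Ux cf; apply/eqP; rewrite -subr_eq0 -normr_le0.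
apply/ler_addgt0Pr => e e0; rewrite add0r.
pose close (v w : V) := [set y | `|'D_w ('D_v f) x - 'D_w ('D_v f) y| < e / 2].
have closeP v' w' : \forall y \near x, close v' w' y.
  have c : {for x, continuous ('D_w' ('D_v' f))}.
    by case: cf => _ /(_ v')[_ /(_ w')]; exact.
  by move/cvgrPdist_lt : c; apply; rewrite divr_gt0.
have : \forall y \near x, [/\ U y, close v w y & close w v y].
  have xU : nbhs x U by exact: open_nbhs_nbhs.
  by apply: filterS3 xU (closeP v w) (closeP w v).
move=> /nbhs_ballP[d /= d0 xd].
(* With this h, s |v| + r |w| <= d / 2 < d for s, r <= h, so all sample points stay in the ball; the
   summand 1 keeps the denominator positive when v = w = 0. *)
pose h := d / 2 / (1 + `|v| + `|w|).
have N0 : 0 < 1 + `|v| + `|w| by rewrite -addrA ltr_pwDl // addr_ge0.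
have h0 : 0 < h by rewrite !divr_gt0.
have small v' w' s r : `|v'| + `|w'| = `|v| + `|w| ->
    0 <= s <= h -> 0 <= r <= h -> ball x d (x + s *: v' + r *: w').
  move=> E /andP[s0 sh] /andP[r0 rh]; rewrite -ball_normE /=.
  rewrite -addrA opprD addrA subrr sub0r normrN.
  rewrite (le_lt_trans (ler_normD _ _)) // !normrZ !ger0_norm //.
  apply: (@le_lt_trans _ _ (h * (`|v'| + `|w'|))).
    by rewrite mulrDr lerD // ler_wpM2r.
  rewrite E; apply: (@le_lt_trans _ _ (d / 2)); last first.
    by rewrite ltr_pdivrMr // ltr_pMr // ltr1n.
  rewrite -[leRHS](divfK (lt0r_neq0 N0)) ler_wpM2l ?(ltW h0) //.
  by rewrite -addrA lerDr.
have [s [r [sh rh E1]]] : exists s r, [/\ 0 <= s <= h, 0 <= r <= h &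
    second_difference f x (h *: v) (h *: w)
    = h ^+ 2 * 'D_w ('D_v f) (x + s *: v + r *: w)].
  apply: (second_difference_mean h0 cf) => s r sh rh.
  by have [] := xd _ (small v w s r erefl sh rh).
have [s' [r' [sh' rh' E2]]] : exists s r, [/\ 0 <= s <= h, 0 <= r <= h &
    second_difference f x (h *: w) (h *: v)
    = h ^+ 2 * 'D_v ('D_w f) (x + s *: w + r *: v)].
  apply: (second_difference_mean h0 cf) => s' r' sh' rh'.
  by have [] := xd _ (small w v s' r' (addrC _ _) sh' rh').
move: E2; rewrite second_difference_sym E1.
move=> /(mulfI (lt0r_neq0 (exprn_gt0 2 h0))) E.
have [_ c1 _] := xd _ (small v w s r erefl sh rh).
have [_ _ c2] := xd _ (small w v s' r' (addrC _ _) sh' rh').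
rewrite /close /= in c1 c2.
rewrite -(subrKA ('D_w ('D_v f) (x + s *: v + r *: w))).
rewrite (splitr e); apply: (le_trans (ler_normD _ _)); apply: lerD.
  exact: ltW c1.
by rewrite E distrC; exact: ltW c2.
Qed.

Lemma derive_comm (m n : nat) (f : V -> 'M[R]_(m, n)) (U : set V) (x v w : V) :
  open U -> U x -> Ck 2 U f -> 'D_w ('D_v f) x = 'D_v ('D_w f) x.
Proof.
move=> oU Ux cf; have [df Df] := cf.
have D2 v' w' i j : ('D_w' ('D_v' f) x) i j =
    'D_w' ('D_v' (fun y => f y i j)) x.
  have [dvf _] := Df v'; rewrite derive_mxE; last exact: dvf.
  apply: near_eq_derive; near=> y; rewrite derive_mxE //; apply: df.
  by near: y; exact: open_nbhs_nbhs.
apply/matrixP => i j; rewrite [LHS]D2 [RHS]D2.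
exact: derive_comm_real oU Ux ((Ck_mxP _ _ oU).1 cf i j).
Unshelve. all: by end_near. Qed.

End Schwarz.

(** * Differentiability of the determinant and of the inverse matrix *)

Section Inverse.
Context {R : realType} {V : normedModType R}.

Lemma differentiable_prod (I : Type) (r : seq I) (f : I -> V -> R) x :
  (forall i, differentiable (f i) x) ->
  differentiable (fun y => \prod_(i <- r) f i y) x.
Proof.
move=> df; elim: r => [|i r IH].
  rewrite (_ : (fun _ => _) = cst 1) //.
  by apply/funext => y; rewrite big_nil.
rewrite (_ : (fun _ => _) = f i * (fun y => \prod_(i <- r) f i y)).
  exact: differentiableM.
by apply/funext => y; rewrite big_cons.
Qed.

Lemma differentiable_det (n : nat) (f : V -> 'M[R]_n) x :
  differentiable f x -> differentiable (fun y => \det (f y)) x.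
Proof.
move=> /differentiable_mxP df.
rewrite /determinant.
elim: (index_enum _) => [|s r IH].
  rewrite (_ : (fun _ => _) = cst 0) //.
  by apply/funext => y; rewrite big_nil.
rewrite (_ : (fun _ => _) = cst ((-1) ^+ s) * (fun y => \prod_i f y i (s i)) +
  (fun y => \sum_(s <- r) (-1) ^+ s * \prod_i f y i (s i))); last first.
  by apply/funext => y; rewrite big_cons.
apply: differentiableD => //; apply: differentiableM => //.
by apply: differentiable_prod => i.
Qed.

(** Cramer's rule writes each entry as a cofactor over the determinant. [invmx] returns its argument
    on a singular matrix, so the formula is available only near x, inside U. *)
Lemma differentiable_invmx (n : nat) (f : V -> 'M[R]_n) (U : set V) x :
  open U -> U x -> (forall y, U y -> f y \in unitmx) ->
  differentiable f x -> differentiable (fun y => invmx (f y)) x.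
Proof.
move=> oU Ux fU df; apply/differentiable_mxP => i j.
have dfij := (differentiable_mxP _ _).1 df.
apply: (@near_eq_differentiable _ _ _
  ((fun y => (\det (f y))^-1) * (cst ((-1) ^+ (j + i)) *
   (fun y => \det (row' j (col' i (f y)))))) _ x).
  near=> y; have /fU fy : U y by near: y; exact: open_nbhs_nbhs.
  by rewrite /invmx fy !mxE.
have d0 : \det (f x) != 0 by rewrite -unitfE -unitmxE fU.
apply: differentiableM; first by apply: differentiableV => //; exact: differentiable_det.
apply: differentiableM => //; apply: differentiable_det.
apply/differentiable_mxP => k l; rewrite (_ : (fun _ => _) = (fun y => f y (lift j k) (lift i l))) //.
by apply/funext => y; rewrite !mxE.
Unshelve. all: by end_near. Qed.

End Inverse.

(** * Partial derivatives on the product of the time line with a space *)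

Section Slices.
Context {R : realType} {V W : normedModType R}.
Implicit Types (f : R * V -> W).

Let slope (U : normedModType R) (g : U -> W) (a v : U) : R -> W :=
  fun h => h^-1 *: (g (h *: v + a) - g a).

(** The difference quotients agree as functions of h, so existence and value of the limit transfer
    together. *)
Let slope_slice1 f t x :
  slope (fun s : R => f (s, x)) t 1 = slope f (t, x) (1, 0).
Proof.
apply/funext => h; rewrite /slope.
have -> : h *: ((1 : R), (0 : V)) + (t, x) = (h *: 1 + t, h *: 0 + x) by [].
by rewrite scaler0 add0r.
Qed.

Let slope_slice2 f t x v :
  slope (fun y => f (t, y)) x v = slope f (t, x) (0, v).
Proof.
apply/funext => h; rewrite /slope.
have -> : h *: ((0 : R), v) + (t, x) = (h *: 0 + t, h *: v + x) by [].
by rewrite scaler0 add0r.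
Qed.

Lemma derive_slice1 f t x :
  'D_(1 : R) (fun s : R => f (s, x)) t = 'D_(1, 0) f (t, x).
Proof.
exact: (congr1 (fun u : R -> W => lim (u @ 0^')) (slope_slice1 f t x)).
Qed.

Lemma is_derive_slice1 f t x : differentiable f (t, x) ->
  is_derive t (1 : R) (fun s : R => f (s, x)) ('D_(1, 0) f (t, x)).
Proof.
move=> df; split; last exact: derive_slice1.
have dfx := @diff_derivable _ _ _ f (t, x) (1, 0) df.
have E := congr1 (fun u : R -> W => cvg (u @ 0^')) (slope_slice1 f t x).
by rewrite /derivable [cvg _]E.
Qed.

Lemma derive_slice2 f t x v :
  'D_v (fun y => f (t, y)) x = 'D_(0, v) f (t, x).
Proof.
exact: (congr1 (fun u : R -> W => lim (u @ 0^')) (slope_slice2 f t x v)).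
Qed.

End Slices.

(** * Curvature under a change of coordinates *)

(* Unification would otherwise try to compare derivatives as limits. *)
#[local] Opaque derive diff jacobian invmx.

Section ScalarMatrix.
Context {R : realType} {V : normedModType R} {m n : nat}.
Implicit Types (c : V -> R) (f : V -> 'M[R]_(m, n)).

Lemma is_derive_scale c f x v dc df :
  is_derive x v c dc -> is_derive x v f df ->
  is_derive x v (fun y => c y *: f y) (dc *: f x + c x *: df).
Proof.
move=> cx /is_derive_mxP fx; apply/is_derive_mxP => i j.
rewrite (_ : (fun _ => _) = c * (fun y => f y i j)); last first.
  by apply/funext => y; rewrite mxE.
have h := @is_deriveM _ _ _ _ _ _ _ _ cx (fx i j).
apply: (is_derive_eq h); rewrite !mxE.
by rewrite addrC; congr (_ + _); exact: mulrC.
Qed.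

Lemma is_derive_bigsum k (f : 'I_k -> V -> 'M[R]_(m, n)) x v df :
  (forall a, is_derive x v (f a) (df a)) ->
  is_derive x v (fun y => \sum_(a < k) f a y) (\sum_(a < k) df a).
Proof.
move=> fx; rewrite (_ : (fun _ => _) = \sum_(a < k) f a).
  exact: is_derive_sum.
by apply/funext => y; rewrite fct_sumE.
Qed.

End ScalarMatrix.

(** * Koszul's formula as matrix algebra *)

Section KoszulAlgebra.
Context {R : fieldType} {n : nat}.
Implicit Types (D : 'I_n -> 'M[R]_n) (A : 'M[R]_n).

(* The Christoffel symbols of the first kind in terms of the partial
   derivatives [D] of the metric. *)
Definition koszul D i : 'M[R]_n :=
  \matrix_(j, l) (2^-1 * (D i j l + D j i l - D l i j)).

(** A three-index array t transformed by A in all its slots. The fixed order of summation lets the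
    permuted terms of Koszul's formula be compared summand by summand. *)
Definition cubic_sum A (i j m : 'I_n) (t : 'I_n -> 'I_n -> 'I_n -> R) :=
  \sum_b \sum_c \sum_d A i b * A j c * A m d * t b c d.

Lemma conj_sumE A i j m D :
  (A *m (\sum_b A i b *: D b) *m A^T) j m = cubic_sum A i j m (fun b => D b).
Proof.
rewrite mulmx_sumr mulmx_suml summxE; apply: eq_bigr => b _.
rewrite -scalemxAr -scalemxAl !mxE mulr_sumr [RHS]exchange_big /=.
apply: eq_bigr => d _; rewrite !mxE mulr_suml mulr_sumr.
by apply: eq_bigr => c _; ring.
Qed.

(** In the application [D] holds the derivatives of the Jacobian matrix A and [D'] those of G, and
    the argument of [koszul] is the derivative of a A G A^T. The symmetry of [D] passes to [P];
    among the six [P] terms of Koszul's formula four then cancel in pairs, and the other two both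
    equal P_i(j, m), which absorbs the factor 1/2. *)
Lemma koszul_conj A (G : 'M[R]_n) D D' (a : R) i :
  2%:R != 0 :> R -> (forall k l r, D k l r = D l k r) ->
  let P k := D k *m G *m A^T in
  koszul (fun k => a *: (P k + A *m (\sum_b A k b *: D' b) *m A^T + (P k)^T)) i
  = a *: (P i + A *m (\sum_b A i b *: koszul D' b) *m A^T).
Proof.
move=> two Dsym P; pose Q k := A *m (\sum_b A k b *: D' b) *m A^T.
apply/matrixP => j m.
have PC k l r : P k l r = P l k r.
  rewrite /P -!mulmxA [LHS]mxE [RHS]mxE; apply: eq_bigr => b _.
  by rewrite Dsym.
have -> : (a *: (P i + A *m (\sum_b A i b *: koszul D' b) *m A^T)) j m =
    a * (P i j m + 2^-1 * (Q i j m + Q j i m - Q m i j)).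
  rewrite mxE [X in a * X]mxE conj_sumE; congr (_ * (_ + _)).
  have -> : Q j i m = cubic_sum A i j m (fun b c d => D' c b d).
    rewrite /Q conj_sumE /cubic_sum exchange_big /=.
    apply: eq_bigr => b _; apply: eq_bigr => c _; apply: eq_bigr => d _.
    by rewrite [_ * A i b]mulrC.
  have -> : Q m i j = cubic_sum A i j m (fun b c d => D' d b c).
    rewrite /Q conj_sumE /cubic_sum exchange_big /=; apply: eq_bigr => b _.
    rewrite exchange_big /=; apply: eq_bigr => c _; apply: eq_bigr => d _.
    by ring.
  rewrite /Q conj_sumE /cubic_sum -big_split /= -sumrB mulr_sumr.
  apply: eq_bigr => b _; rewrite -big_split /= -sumrB mulr_sumr.
  apply: eq_bigr => c _; rewrite -big_split /= -sumrB mulr_sumr.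
  by apply: eq_bigr => d _; rewrite mxE; ring.
have E k l r : (a *: (P k + Q k + (P k)^T)) l r
    = a * (P k l r + Q k l r + P k r l) by rewrite mxE [X in a * X]mxE !mxE.
by rewrite mxE !E (PC j m i) (PC j i m) (PC i m j); field.
Qed.

End KoszulAlgebra.

(** * Connection and curvature matrices *)

Section ConnectionMatrices.
Context {R : realType} {n : nat}.
Implicit Types (G : 'rV[R]_n -> 'M[R]_n) (x : 'rV[R]_n) (U : set 'rV[R]_n).

Definition christoffel_mx G i x : 'M[R]_n :=
  \matrix_(k, l) christoffel G i k l x.

Definition riemann_mx G i j x : 'M[R]_n := \matrix_(k, l) riemann G i j k l x.

Definition christoffel1 G i x : 'M[R]_n :=
  \matrix_(j, l) (2^-1 * (partial i (fun y => G y j l) x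
    + partial j (fun y => G y i l) x - partial l (fun y => G y i j) x)).

Lemma christoffel1E G i x : differentiable G x ->
  christoffel1 G i x = koszul (fun k => 'D_(delta_mx 0 k) G x) i.
Proof.
move=> dG; have E a b c :
    partial a (fun y => G y b c) x = ('D_(delta_mx 0 a) G x) b c.
  exact/esym/derive_mxE.
by apply/matrixP => j l; rewrite [LHS]mxE [RHS]mxE !E.
Qed.

Lemma christoffel_mxE G i x :
  christoffel_mx G i x = christoffel1 G i x *m (invmx (G x))^T.
Proof.
apply/matrixP => j k; rewrite !mxE /christoffel mulr_sumr.
by apply: eq_bigr => l _; rewrite !mxE -mulrA; congr (_ * _); rewrite mulrC.
Qed.

Lemma christoffel_mx_mul G i x : (G x)^T = G x -> G x \in unitmx ->
  christoffel_mx G i x *m G x = christoffel1 G i x.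
Proof. by move=> sG uG; rewrite christoffel_mxE trmx_inv sG mulmxKV. Qed.

Lemma differentiable_christoffel_mx G i U x :
  open U -> U x -> Ck 2 U G -> (forall y, U y -> G y \in unitmx) ->
  differentiable (christoffel_mx G i) x.
Proof.
move=> oU Ux cG uG.
rewrite (_ : christoffel_mx G i = fun y =>
  christoffel1 G i y *m (invmx (G y))^T); last first.
  by apply/funext => y; exact: christoffel_mxE.
apply: differentiable_mulmx.
  have dp a b c : differentiable (partial a (fun y => G y b c)) x.
    have [_ /(_ (delta_mx 0 a))[+ _]] := (Ck_mxP _ _ oU).1 cG b c.
    exact.
  apply/differentiable_mxP => j l.
  rewrite (_ : (fun _ => _) = 2^-1 *: (partial i (fun y => G y j l)
    + partial j (fun y => G y i l) - partial l (fun y => G y i j))).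
    by apply: differentiableZ; apply: differentiableB => //;
      exact: differentiableD.
  by apply/funext => y; rewrite mxE.
have dG : differentiable G x by case: cG => + _; exact.
have /differentiable_mxP dV := differentiable_invmx oU Ux uG dG.
apply/differentiable_mxP => j l; rewrite (_ : (fun _ => _) =
  fun y => (invmx (G y)) l j) //.
by apply/funext => y; rewrite mxE.
Qed.

(** Matrices act on the right, so composing nabla_i after nabla_j multiplies the connection matrices
    in the opposite order; this fixes the sign of the commutator. *)
Lemma riemann_mxE G i j x :
  (forall i, differentiable (christoffel_mx G i) x) ->
  riemann_mx G i j x =
    'D_(delta_mx 0 i) (christoffel_mx G j) x
    - 'D_(delta_mx 0 j) (christoffel_mx G i) x
    + (christoffel_mx G j x *m christoffel_mx G i x
       - christoffel_mx G i x *m christoffel_mx G j x).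
Proof.
move=> dC; have entry a b k l : ('D_(delta_mx 0 a) (christoffel_mx G b) x) k l
    = partial a (christoffel G b k l) x.
  have -> : christoffel G b k l = fun y => christoffel_mx G b y k l.
    by apply/funext => y; rewrite mxE.
  by rewrite /partial; exact: derive_mxE.
apply/matrixP => k l; rewrite mxE /riemann -!entry !mxE.
by rewrite sumrB; congr (_ + (_ - _)); apply: eq_bigr => m _; rewrite !mxE.
Qed.

End ConnectionMatrices.

(* M and g stand for the connection matrices of the two metrics; d1 and d2 are
   the first derivatives of A, d12 its mixed second derivative, and M21, g21
   the derivatives of M2, g2 in direction 1. *)
Lemma curvature_gauge (R : comNzRingType) (n : nat)
    (A M1 M2 g1 g2 d1 d2 d12 M21 M12 g21 g12 : 'M[R]_n) :
  M1 *m A = d1 + A *m g1 -> M2 *m A = d2 + A *m g2 ->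
  M21 *m A + M2 *m d1 = d12 + (d1 *m g2 + A *m g21) ->
  M12 *m A + M1 *m d2 = d12 + (d2 *m g1 + A *m g12) ->
  (M21 - M12 + (M2 *m M1 - M1 *m M2)) *m A
  = A *m (g21 - g12 + (g2 *m g1 - g1 *m g2)).
Proof.
(* The differentiated laws are solved for M21 A and M12 A. The common term d12 drops out of their
   difference, and the products M2 d1, M1 d2, d1 g2 and d2 g1 cancel against those produced by the
   commutator. *)
move=> E1 E2 /(canRL (addrK _)) E21 /(canRL (addrK _)) E12.
rewrite !(mulmxDl, mulmxDr, mulmxN, mulNmx) E21 E12 -(mulmxA M2) -(mulmxA M1).
rewrite E1 E2 !mulmxDr !mulmxA E1 E2 !mulmxDl.
move: (M2 *m d1) (M1 *m d2) (d1 *m g2) (d2 *m g1) => u1 u2 u3 u4.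
move: (A *m g21) (A *m g12) (A *m g2 *m g1) (A *m g1 *m g2) => u5 u6 u7 u8.
by apply/matrixP => i j; rewrite !mxE; ring.
Qed.

(** This evaluates the right-hand factor of [curvature_gauge] for g_i = sum_b A_ib Gamma_b(F), with
    u and w the rows i and j of A. The second derivatives of F form p, the same in both orders, and
    their contribution cancels. *)
Lemma curvature_sumE (R : comNzRingType) (n : nat) (u w p : 'I_n -> R)
    (C : 'I_n -> 'M[R]_n) (D : 'I_n -> 'I_n -> 'M[R]_n) :
  \sum_b (p b *: C b + w b *: \sum_c u c *: D c b)
  - \sum_b (p b *: C b + u b *: \sum_c w c *: D c b)
  + ((\sum_b w b *: C b) *m (\sum_b u b *: C b)
     - (\sum_b u b *: C b) *m (\sum_b w b *: C b))
  = \sum_b \sum_c (u b * w c) *: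
      (D b c - D c b + (C c *m C b - C b *m C c)).
Proof.
have scaleE (s t : 'I_n -> R) (Z : 'I_n -> 'I_n -> 'M[R]_n) :
    \sum_b s b *: \sum_c t c *: Z c b
    = \sum_b \sum_c (s b * t c) *: Z c b.
  by apply: eq_bigr => b _; rewrite scaler_sumr; apply: eq_bigr => c _;
    rewrite scalerA.
have mulE (s t : 'I_n -> R) : (\sum_b s b *: C b) *m (\sum_b t b *: C b)
    = \sum_b \sum_c (s b * t c) *: (C b *m C c).
  rewrite mulmx_suml; apply: eq_bigr => b _; rewrite mulmx_sumr.
  by apply: eq_bigr => c _; rewrite -scalemxAl -scalemxAr scalerA.
have swap (Z : 'I_n -> 'I_n -> 'M[R]_n) :
    \sum_b \sum_c (w b * u c) *: Z b c = \sum_b \sum_c (u b * w c) *: Z c b.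
  rewrite exchange_big /=; apply: eq_bigr => b _; apply: eq_bigr => c _.
  by rewrite mulrC.
have subD (x y z : 'M[R]_n) : x + y - (x + z) = y - z.
  by rewrite opprD addrACA subrr add0r.
rewrite !big_split /= subD !scaleE !mulE !swap.
rewrite -!sumrB -big_split /=; apply: eq_bigr => b _.
rewrite -!sumrB -big_split /=; apply: eq_bigr => c _.
by rewrite -!scalerBr -scalerDr.
Qed.

(** * The gauge law and its derivative, for a local change of coordinates F *)

Section CoordinateChange.
Context {R : realType} {n : nat}.
Variables (F : 'rV[R]_n -> 'rV[R]_n) (G H : 'rV[R]_n -> 'M[R]_n) (a : R).
Variables U V : set 'rV[R]_n.
Hypotheses (oU : open U) (oV : open V) (UV : forall x, U x -> V (F x)).
(** Curvature takes two derivatives of H, and H already contains the first derivative of F. *)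
Hypotheses (cF : Ck 3 U F) (cG : Ck 2 V G).
Hypotheses (symG : forall y, V y -> (G y)^T = G y).
Hypotheses (unitG : forall y, V y -> G y \in unitmx).
Hypotheses (unitJ : forall x, U x -> 'J F x \in unitmx) (a_neq0 : a != 0).
Hypothesis HE : forall x, U x -> H x = a *: ('J F x *m G (F x) *m ('J F x)^T).

Local Notation e i := (delta_mx 0 i : 'rV[R]_n).
Local Notation A := (fun x => 'J F x).
Local Notation Gam i :=
  (fun x => \sum_b 'J F x i b *: christoffel_mx G b (F x)).

Let dF x : U x -> differentiable F x.
Proof. by case: cF => + _; exact. Qed.

Let cA : Ck 2 U A.
Proof. exact: Ck_jacobian. Qed.

Let dA x : U x -> differentiable A x.
Proof. by case: cA => + _; exact. Qed.

Let dG y : V y -> differentiable G y.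
Proof. by case: cG => + _; exact. Qed.

Let AE x i b : U x -> A x i b = ('D_(e i) F x) 0 b.
Proof. by move=> /dF; exact: jacobianE. Qed.

Let near_U x : U x -> \forall y \near x, U y.
Proof. by move=> Ux; exact: open_nbhs_nbhs. Qed.

Let derive_A x v i b : U x ->
  ('D_v A x) i b = ('D_v ('D_(e i) F) x) 0 b.
Proof.
move=> Ux; have [_ /(_ (e i))[dDF _]] := cF.
rewrite [LHS]derive_mxE; last exact: dA.
rewrite [RHS]derive_mxE; last exact: dDF.
by apply: near_eq_derive; apply: filterS (near_U Ux) => y; exact: AE.
Qed.

Let derive_A_sym x i j b : U x -> ('D_(e i) A x) j b = ('D_(e j) A x) i b.
Proof.
move=> Ux; rewrite [LHS](derive_A _ _ _ Ux) [RHS](derive_A _ _ _ Ux).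
have E := derive_comm (e j) (e i) oU Ux (CkW cF).
exact: (congr1 (fun M : 'rV[R]_n => M 0 b) E).
Qed.

Let pull_derive (K : 'rV[R]_n -> 'M[R]_n) x i : U x ->
  differentiable K (F x) ->
  is_derive x (e i) (fun y => K (F y)) (\sum_b A x i b *: 'D_(e b) K (F x)).
Proof.
move=> Ux dK; split.
  exact/diff_derivable/(differentiable_comp (dF Ux) dK).
rewrite [LHS](derive_comp _ (dF Ux) dK) derive_delta_sum //.
by apply: eq_bigr => b _; rewrite (AE _ _ Ux).
Qed.

Let symH x : U x -> (H x)^T = H x.
Proof.
move=> Ux; rewrite (HE Ux) linearZ /= !trmx_mul trmxK mulmxA symG //; exact: UV.
Qed.

Let unitH x : U x -> H x \in unitmx.
Proof.
move=> Ux; rewrite (HE Ux) unitmxZ ?unitfE // !unitmx_mul unitmx_tr unitJ //.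
by rewrite unitG //; exact: UV.
Qed.

Let cH : Ck 2 U H.
Proof.
have cGF : Ck 2 U (G \o F) := Ck_comp oU oV UV (CkW cF) cG.
have h := Ck_scale a oU (Ck_mulmx oU (Ck_mulmx oU cA cGF) (Ck_trmx oU cA)).
by apply: (Ck_congr oU _ h) => x; rewrite inE => /HE ->.
Qed.

Let dH x : U x -> differentiable H x.
Proof. by case: cH => + _; exact. Qed.

Let dCG b y : V y -> differentiable (christoffel_mx G b) y.
Proof. by move=> Vy; exact: differentiable_christoffel_mx oV Vy cG unitG. Qed.

Let dCH b x : U x -> differentiable (christoffel_mx H b) x.
Proof. by move=> Ux; exact: differentiable_christoffel_mx oU Ux cH unitH. Qed.

(** Symmetry of G makes the term that differentiates A^T the transpose of the one that
    differentiates A, the shape required by [koszul_conj]. *)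
Let derive_H x i : U x -> 'D_(e i) H x =
  a *: ('D_(e i) A x *m G (F x) *m (A x)^T
    + A x *m (\sum_b A x i b *: 'D_(e b) G (F x)) *m (A x)^T
    + ('D_(e i) A x *m G (F x) *m (A x)^T)^T).
Proof.
move=> Ux; have isA : is_derive x (e i) A ('D_(e i) A x).
  exact/differentiable_is_derive/dA.
have isG := pull_derive i Ux (dG (UV Ux)).
have h := @is_deriveZ _ _ _ _ a _ _ _
  (is_derive_mulmx (is_derive_mulmx isA isG) (is_derive_trmx isA)).
have nH : \forall y \near x, a *: (A y *m G (F y) *m (A y)^T) = H y.
  by apply: filterS (near_U Ux) => y /HE ->.
rewrite [LHS](@derive_val _ _ _ _ _ _ _ (near_eq_is_derive nH h)).
congr (_ *: _).
rewrite mulmxDl trmx_mul trmxK trmx_mul mulmxA symG //; exact: UV.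
Qed.

Let christoffel1_H x i : U x -> christoffel1 H i x =
  a *: ('D_(e i) A x *m G (F x) *m (A x)^T
    + A x *m (\sum_b A x i b *: christoffel1 G b (F x)) *m (A x)^T).
Proof.
move=> Ux; rewrite (christoffel1E _ (dH Ux)).
have DH := funext (fun k => derive_H k Ux).
rewrite [LHS](congr1 (koszul^~ i) DH).
under [in RHS]eq_bigr => b _ do rewrite (christoffel1E b (dG (UV Ux))).
apply: (@koszul_conj _ _ (A x) (G (F x)) (fun k => 'D_(e k) A x)
  (fun b => 'D_(e b) G (F x))).
- by rewrite pnatr_eq0.
- by move=> k l r; exact: derive_A_sym.
Qed.

Lemma christoffel_pullback x i : U x ->
  christoffel_mx H i x *m A x = 'D_(e i) A x + A x *m Gam i x.
Proof.
move=> Ux; have uG : G (F x) \in unitmx by exact/unitG/UV.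
(* Right multiplication by this invertible matrix completes A to H, turning both connection matrices
   into Christoffel symbols of the first kind, where Koszul's formula applies. The constant a then
   cancels, whence the scaling invariance. *)
have uB : a *: (G (F x) *m (A x)^T) \in unitmx.
  by rewrite unitmxZ ?unitfE // unitmx_mul uG unitmx_tr unitJ.
apply: (can_inj (mulmxK uB)).
have := christoffel_mx_mul i (symH Ux) (unitH Ux).
rewrite christoffel1_H // {1}HE // -!scalemxAr => /(scalerI a_neq0).
rewrite -!mulmxA => ->; congr (_ *: _); rewrite mulmxDl !mulmxA; congr (_ + _).
congr (_ *m _); rewrite -mulmxA; congr (_ *m _).
rewrite mulmx_suml; apply: eq_bigr => b _; rewrite -scalemxAl.
by rewrite christoffel_mx_mul //; exact/symG/UV.
Qed.

Let derive_Gam x i j : U x -> is_derive x (e i) (Gam j)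
  (\sum_b ('D_(e i) A x j b *: christoffel_mx G b (F x)
    + A x j b *: \sum_c A x i c *: 'D_(e c) (christoffel_mx G b) (F x))).
Proof.
move=> Ux; apply: is_derive_bigsum => b; apply: is_derive_scale.
  exact: (is_derive_mxP _ _ _ _).1 (differentiable_is_derive (e i) (dA Ux)) j b.
by apply: pull_derive => //; exact/dCG/UV.
Qed.

Lemma riemann_pullback x i j : U x ->
  riemann_mx H i j x *m A x =
  A x *m \sum_b \sum_c (A x i b * A x j c) *: riemann_mx G b c (F x).
Proof.
move=> Ux.
(* The gauge law holds on the whole open set U, so both sides may be differentiated at x. *)
have law k l : 'D_(e l) (christoffel_mx H k) x *m A x
      + christoffel_mx H k x *m 'D_(e l) A x
    = 'D_(e l) ('D_(e k) A) x + ('D_(e l) A x *m Gam k x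
      + A x *m 'D_(e l) (Gam k) x).
  have isA : is_derive x (e l) A ('D_(e l) A x).
    exact/differentiable_is_derive/dA.
  have isD : is_derive x (e l) ('D_(e k) A) ('D_(e l) ('D_(e k) A) x).
    apply: differentiable_is_derive; have [_ /(_ (e k))[+ _]] := cA; exact.
  have isC : is_derive x (e l) (christoffel_mx H k)
      ('D_(e l) (christoffel_mx H k) x).
    exact/differentiable_is_derive/dCH.
  have isG : is_derive x (e l) (Gam k) ('D_(e l) (Gam k) x).
    by apply: derivableP; have [] := derive_Gam l k Ux.
  have hL := is_derive_mulmx isC isA.
  have hR := @is_deriveD _ _ _ _ _ _ _ _ _ isD (is_derive_mulmx isA isG).
  have nE : \forall y \near x,
      christoffel_mx H k y *m A y = 'D_(e k) A y + A y *m Gam k y.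
    by apply: filterS (near_U Ux) => y; exact: christoffel_pullback.
  by rewrite -(@derive_val _ _ _ _ _ _ _ hR)
    -(@derive_val _ _ _ _ _ _ _ (near_eq_is_derive nE hL)).
rewrite riemann_mxE => [|k]; last exact: dCH.
have D2 := derive_comm (e i) (e j) oU Ux cA.
(* Exchanging the two derivatives of A makes both differentiated laws contain the same mixed
   term. *)
have L := law i j; rewrite D2 in L.
rewrite [LHS](curvature_gauge (christoffel_pullback i Ux)
  (christoffel_pullback j Ux) (law j i) L); congr (_ *m _).
rewrite (@derive_val _ _ _ _ _ _ _ (derive_Gam i j Ux)).
rewrite (@derive_val _ _ _ _ _ _ _ (derive_Gam j i Ux)).
under [X in _ - X]eq_bigr => b _ do rewrite (derive_A_sym j i b Ux).
rewrite (curvature_sumE (A x i) (A x j) (fun b => 'D_(e i) A x j b)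
  (fun b => christoffel_mx G b (F x))
  (fun b c => 'D_(e b) (christoffel_mx G c) (F x))).
apply: eq_bigr => b _; apply: eq_bigr => c _; congr (_ *: _).
by apply/esym/riemann_mxE => k; exact/dCG/UV.
Qed.

End CoordinateChange.

(** * Naturality on a manifold *)

(* [coord] also names the coordinates with respect to a basis in vector.v. *)
Local Notation coord := Defs.coord.

Section LocalRepresentatives.
Context {R : realType} {n : nat} {M : manifold R n}.
Implicit Types (f g h : M -> M) (c d : chart R n M) (x : 'rV[R]_n).
Implicit Types (b : bilin_field M) (X : vector_field M) (p : M).

Definition local_rep f c d x := coord d (f (param c x)).

Definition rep_domain f c d : set 'rV[R]_n :=
  [set x | target c x /\ source d (f (param c x))].

Lemma open_rep_domain f c d : continuous f -> open (rep_domain f c d).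
Proof.
move=> cf; rewrite openE => x [cx dx].
have nt : nbhs x (target c) by apply: open_nbhs_nbhs; split => //; exact: target_open.
have nd : nbhs (f (param c x)) (source d).
  by apply: open_nbhs_nbhs; split => //; exact: source_open.
have nfd := param_continuous cx (cf (param c x) _ nd).
by apply: filterS2 nt nfd.
Qed.

Lemma near_rep_domain f c d x : smooth_map f -> rep_domain f c d x ->
  \forall y \near x, rep_domain f c d y.
Proof.
by move=> [cf _] Ux; apply: open_nbhs_nbhs; split; [exact: open_rep_domain|].
Qed.

(** Local representatives of the identity are transition maps. Change-of-basis matrices thus become
    Jacobian matrices of representatives, and one chain rule serves for them and for tangent
    maps. *)
Lemma smooth_map_id : smooth_map (@id M).
Proof. by split=> [p|c d ac ad]; [exact: cvg_id|exact: atlas_smooth]. Qed.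

Lemma Ck_local_rep f c d k : smooth_map f -> atlas c -> atlas d ->
  Ck k (rep_domain f c d) (local_rep f c d).
Proof. by move=> [_ sf] ac ad; exact: sf. Qed.

Lemma differentiable_local_rep f c d x : smooth_map f -> atlas c -> atlas d ->
  rep_domain f c d x -> differentiable (local_rep f c d) x.
Proof. by move=> sf ac ad; have [+ _] := Ck_local_rep 1 sf ac ad; exact. Qed.

Lemma jacobian_local_rep_comp f g c d e x :
  smooth_map f -> smooth_map g -> atlas c -> atlas d -> atlas e ->
  target c x -> source d (f (param c x)) -> source e (g (f (param c x))) ->
  'J (local_rep (g \o f) c e) x =
  'J (local_rep f c d) x *m 'J (local_rep g d e) (local_rep f c d x).
Proof.
move=> sf sg ac ad ae cx dx ex.
have df : differentiable (local_rep f c d) x by exact: differentiable_local_rep.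
have dg : differentiable (local_rep g d e) (local_rep f c d x).
  apply: differentiable_local_rep => //; split; first exact: coord_target.
  by rewrite /local_rep coordK.
rewrite -(jacobian_comp df dg); apply/esym/near_eq_jacobian.
  have nU := near_rep_domain sf (conj cx dx : rep_domain f c d x).
  by apply: filterS nU => y [_ dy]; rewrite /local_rep /= coordK.
exact: differentiable_comp.
Qed.

Lemma jacobian_local_rep_id c x : target c x -> 'J (local_rep id c c) x = 1%:M.
Proof.
move=> cx; rewrite -(jacobian_id x); apply/esym/near_eq_jacobian; last first.
  exact: ex_diff.
have nt : nbhs x (target c).
  by apply: open_nbhs_nbhs; split => //; exact: target_open.
by apply: filterS nt => y cy; rewrite /local_rep paramK.
Qed.

Lemma jacobian_local_rep_unit f h c d x :
  cancel f h -> smooth_map f -> smooth_map h -> atlas c -> atlas d ->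
  rep_domain f c d x -> 'J (local_rep f c d) x \in unitmx.
Proof.
move=> fK sf sh ac ad [cx dx].
have hfx : source c (h (f (param c x))) by rewrite fK; exact: param_source.
have := jacobian_local_rep_comp sf sh ac ad ac cx dx hfx.
rewrite (_ : h \o f = id); last by apply/funext => p; exact: fK.
rewrite (jacobian_local_rep_id cx) => E.
exact: (mulmx1_unit (esym E)).1.
Qed.

Lemma from_chartE c x : target c x ->
  from_chart c (param c x) = 'J (local_rep id c (chart_at (param c x))) x.
Proof. by move=> cx; rewrite /from_chart paramK. Qed.

Lemma from_chart_self p : from_chart (chart_at p) p = 1%:M.
Proof.
exact/jacobian_local_rep_id/coord_target/chart_at_source.
Qed.

Lemma bilin_in_self b p :
  bilin_in (chart_at p) b (coord (chart_at p) p) = b p.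
Proof.
rewrite /bilin_in coordK; last exact: chart_at_source.
by rewrite from_chart_self trmx1 mulmx1 mul1mx.
Qed.

Lemma vector_in_self X p :
  vector_in (chart_at p) X (coord (chart_at p) p) = X p.
Proof.
rewrite /vector_in coordK; last exact: chart_at_source.
(* At p in its own chart the two change-of-basis matrices are by definition the same Jacobian
   matrix. *)
by rewrite -[to_chart _ _]/(from_chart _ _) from_chart_self mulmx1.
Qed.

Lemma tangent_mapE f p : tangent_map f p =
  'J (local_rep f (chart_at p) (chart_at (f p))) (coord (chart_at p) p).
Proof. by []. Qed.

(** Both sides are the Jacobian matrix of f read from c to the preferred chart at the image point,
    factored through the preferred chart at the source on the left and through d on the right. *)
Lemma from_chart_tangent_map f c d x :
  smooth_map f -> atlas c -> atlas d -> rep_domain f c d x ->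
  from_chart c (param c x) *m tangent_map f (param c x)
  = 'J (local_rep f c d) x *m from_chart d (f (param c x)).
Proof.
move=> sf ac ad [cx dx]; have sid := smooth_map_id.
set q := param c x; have sq := chart_at_source q.
have aq := chart_at_atlas q; have afq := chart_at_atlas (f q).
have sfq := chart_at_source (f q).
have E := jacobian_local_rep_comp sid sf ac aq afq cx sq sfq.
have E' := jacobian_local_rep_comp sf sid ac ad afq cx dx sfq.
by rewrite /q (from_chartE cx) -/q; exact: etrans (esym E) E'.
Qed.

Lemma bilin_in_pullback f b c d x :
  smooth_map f -> atlas c -> atlas d -> rep_domain f c d x ->
  bilin_in c (pullback_bilin f b) x =
  'J (local_rep f c d) x *m bilin_in d b (local_rep f c d x)
    *m ('J (local_rep f c d) x)^T.
Proof.
move=> sf ac ad Ux; have [_ dx] := Ux.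
have conjM (B T g : 'M[R]_n) :
    B *m (T *m g *m T^T) *m B^T = (B *m T) *m g *m (B *m T)^T.
  by rewrite trmx_mul !mulmxA.
have -> : bilin_in d b (local_rep f c d x) = from_chart d (f (param c x))
    *m b (f (param c x)) *m (from_chart d (f (param c x)))^T.
  by rewrite /bilin_in /local_rep (coordK dx).
have E := from_chart_tangent_map sf ac ad Ux.
have E' := congr1 (fun B => B *m b (f (param c x)) *m B^T) E.
exact: etrans (conjM _ _ _) (etrans E' (esym (conjM _ _ _))).
Qed.

End LocalRepresentatives.

(** * Pulled-back and rescaled metrics *)

Section Metrics.
Context {R : realType} {n : nat} {M : manifold R n}.
Implicit Types (f h : M -> M) (c d : chart R n M) (x : 'rV[R]_n).
Implicit Types (g : bilin_field M) (phi : endo_field M) (p : M).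

Lemma definite_unitmx (B : 'M[R]_n) :
  (forall v : 'rV[R]_n, v != 0 -> 0 < (v *m B *m v^T) 0 0) -> B \in unitmx.
Proof.
move=> posB; rewrite -row_free_unit; apply: inj_row_free => v vB0.
apply/eqP; apply: contraT => /posB; by rewrite vB0 mul0mx mxE ltxx.
Qed.

Lemma definite_conj (B T : 'M[R]_n) : T \in unitmx ->
  (forall v : 'rV[R]_n, v != 0 -> 0 < (v *m B *m v^T) 0 0) ->
  forall v : 'rV[R]_n, v != 0 -> 0 < (v *m (T *m B *m T^T) *m v^T) 0 0.
Proof.
move=> uT posB v v0; have vT0 : v *m T != 0.
  by apply: contraNneq v0 => /(congr1 (mulmx^~ (invmx T))); rewrite mulmxK // mul0mx => ->.
by have := posB _ vT0; rewrite trmx_mul !mulmxA.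
Qed.

Lemma from_chart_unit c x : atlas c -> target c x ->
  from_chart c (param c x) \in unitmx.
Proof.
move=> ac cx; rewrite from_chartE //.
have sid := @smooth_map_id _ _ M.
apply: (jacobian_local_rep_unit _ sid sid ac (chart_at_atlas _)) => //.
by split => //; exact: chart_at_source.
Qed.

Lemma bilin_in_sym g c x : riemannian_metric g -> (bilin_in c g x)^T = bilin_in c g x.
Proof. by move=> [_ sg _]; rewrite /bilin_in !trmx_mul trmxK sg mulmxA. Qed.

Lemma bilin_in_unit g c x : riemannian_metric g -> atlas c -> target c x ->
  bilin_in c g x \in unitmx.
Proof.
move=> [_ _ pg] ac cx; apply: definite_unitmx; apply: definite_conj (pg _).
exact: from_chart_unit.
Qed.

Lemma tangent_map_unit f p : diffeomorphism f -> tangent_map f p \in unitmx.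
Proof.
move=> [h [fK _ sf sh]]; rewrite tangent_mapE.
apply: (jacobian_local_rep_unit fK sf sh); [exact: chart_at_atlas..|].
have sp := chart_at_source p.
by split; [exact: coord_target|rewrite coordK //; exact: chart_at_source].
Qed.

Lemma bilin_in_scale g c x a :
  bilin_in c (fun p => a *: g p) x = a *: bilin_in c g x.
Proof. by rewrite /bilin_in -scalemxAr -scalemxAl. Qed.

Lemma bilin_in_scale_pullback f g c d x a :
  smooth_map f -> atlas c -> atlas d -> rep_domain f c d x ->
  bilin_in c (fun p => a *: pullback_bilin f g p) x =
  a *: ('J (local_rep f c d) x *m bilin_in d g (local_rep f c d x)
    *m ('J (local_rep f c d) x)^T).
Proof.
move=> sf ac ad Ux; apply: etrans (bilin_in_scale _ _ _ _) _.
exact: (congr1 (fun B : 'M[R]_n => a *: B) (bilin_in_pullback g sf ac ad Ux)).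
Qed.

Lemma riemannian_metric_pullback f g a : 0 < a ->
  diffeomorphism f -> riemannian_metric g ->
  riemannian_metric (fun p => a *: pullback_bilin f g p).
Proof.
move=> a0 df mg; have [smg symg posg] := mg; have [h [_ _ sf _]] := df.
split=> [c ac k|p|p v v0].
(* One target chart need not contain the image of all of [target c], so smoothness is checked on a
   [rep_domain] chosen around each point. *)
- apply: Ck_local => x cx.
  pose d := chart_at (f (param c x)); have ad : atlas d by exact: chart_at_atlas.
  have Ux : rep_domain f c d x by split => //; exact: chart_at_source.
  exists (rep_domain f c d) => //.
  have oU : open (rep_domain f c d) by apply: open_rep_domain; case: sf.
  have cJ := Ck_jacobian oU (Ck_local_rep k.+1 sf ac ad).
  have UV y : rep_domain f c d y -> target d (local_rep f c d y).
    by move=> [_ dy]; exact: coord_target.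
  have cG := Ck_comp oU (@target_open _ _ _ d) UV (Ck_local_rep k sf ac ad) (smg d ad k).
  have cH := Ck_scale a oU (Ck_mulmx oU (Ck_mulmx oU cJ cG) (Ck_trmx oU cJ)).
  apply: (Ck_congr oU _ cH) => y; rewrite inE => Uy.
  exact: esym (bilin_in_scale_pullback g a sf ac ad Uy).
- by rewrite linearZ /= /pullback_bilin !trmx_mul trmxK symg mulmxA.
- rewrite -scalemxAr -scalemxAl mxE mulr_gt0 //.
  by apply: definite_conj v0; [exact: tangent_map_unit|exact: posg].
Qed.

End Metrics.

(** * Naturality of the curvature and of the star-Ricci tensor *)

Section Naturality.
Context {R : realType} {n : nat} {M : manifold R n}.
Implicit Types (f : M -> M) (g : bilin_field M) (phi : endo_field M) (p : M).

(** Bilinear extension of [riemann_pullback] from coordinate vectors to arbitrary u and w: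
    contracting u_i with T_ib yields the components of u T. *)
Lemma conj_form_sum (T : 'M[R]_n) (Z Z' : 'I_n -> 'I_n -> 'M[R]_n)
    (u w : 'rV[R]_n) :
  (forall i j, Z' i j *m T =
     T *m \sum_b \sum_c (T i b * T j c) *: Z b c) ->
  (\sum_i \sum_j (u 0 i * w 0 j) *: Z' i j) *m T =
  T *m \sum_b \sum_c ((u *m T) 0 b * (w *m T) 0 c) *: Z b c.
Proof.
move=> ZT; pose r i j b c := (u 0 i * w 0 j * (T i b * T j c)) *: Z b c.
transitivity (T *m \sum_i \sum_j \sum_b \sum_c r i j b c).
  rewrite mulmx_suml mulmx_sumr; apply: eq_bigr => i _.
  rewrite mulmx_suml mulmx_sumr; apply: eq_bigr => j _.
  rewrite -scalemxAl ZT scalemxAr scaler_sumr; congr (_ *m _).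
  apply: eq_bigr => b _; rewrite scaler_sumr; apply: eq_bigr => c _.
  by rewrite scalerA.
congr (_ *m _); rewrite pair_bigA /= exchange_big; apply: eq_bigr => b _ /=.
rewrite exchange_big; apply: eq_bigr => c _ /=; rewrite -scaler_suml.
congr (_ *: _); rewrite !mxE big_distrlr /= pair_bigA /=.
by apply: eq_bigr => -[i j] _ /=; ring.
Qed.

Lemma curvatureE g p u w : curvature g p u w = \sum_i \sum_j (u 0 i * w 0 j) *:
  riemann_mx (bilin_in (chart_at p) g) i j (coord (chart_at p) p).
Proof.
apply/matrixP => k l; rewrite mxE summxE; apply: eq_bigr => i _.
by rewrite summxE; apply: eq_bigr => j _; rewrite !mxE.
Qed.

Lemma curvature_suml g p (u w : 'rV[R]_n) :
  curvature g p u w = \sum_i u 0 i *: curvature g p (delta_mx 0 i) w.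
Proof.
pose Z i j := riemann_mx (bilin_in (chart_at p) g) i j (coord (chart_at p) p).
have E u' w' : curvature g p u' w' = \sum_i \sum_j (u' 0 i * w' 0 j) *: Z i j.
  exact: curvatureE.
rewrite [LHS]E; apply: eq_bigr => i _; rewrite [in RHS]E; clearbody Z => {E}.
rewrite [in RHS](bigD1 i) //= [X in _ + X]big1 => [|k ki]; last first.
  by apply: big1 => j _; rewrite mxE eqxx /= (negbTE ki) mul0r scale0r.
rewrite addr0 scaler_sumr; apply: eq_bigr => j _.
by rewrite mxE !eqxx mul1r scalerA.
Qed.

Lemma curvature_sumr g p (u w : 'rV[R]_n) :
  curvature g p u w = \sum_j w 0 j *: curvature g p u (delta_mx 0 j).
Proof.
pose Z i j := riemann_mx (bilin_in (chart_at p) g) i j (coord (chart_at p) p).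
have E u' w' : curvature g p u' w' = \sum_i \sum_j (u' 0 i * w' 0 j) *: Z i j.
  exact: curvatureE.
rewrite [LHS]E exchange_big; apply: eq_bigr => j _ /=; rewrite [in RHS]E.
clearbody Z => {E}; rewrite scaler_sumr; apply: eq_bigr => i _.
rewrite [in RHS](bigD1 j) //= [X in _ + X]big1 => [|k kj]; last first.
  by rewrite mxE eqxx /= (negbTE kj) mulr0 scale0r.
by rewrite mxE !eqxx mulr1 addr0 scalerA mulrC.
Qed.

(** [star_ricci] is defined by its entries on basis vectors, whereas naturality evaluates it on
    their images under the tangent map; linearity of the curvature in both slots bridges the gap. *)
Lemma star_ricciE phi g p (u w : 'rV[R]_n) :
  (u *m star_ricci phi g p *m w^T) 0 0 =
  2^-1 * \tr (phi p *m curvature g p u (w *m phi p)).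
Proof.
have vE : w *m phi p = \sum_j w 0 j *: (delta_mx 0 j *m phi p).
  by rewrite {1}[w]row_sum_delta mulmx_suml; apply: eq_bigr => j _; rewrite scalemxAl.
have lin : curvature g p u (w *m phi p) =
    \sum_j w 0 j *: curvature g p u (delta_mx 0 j *m phi p).
  rewrite curvature_sumr.
  under [in RHS]eq_bigr => j _ do rewrite curvature_sumr scaler_sumr.
  rewrite exchange_big /=; apply: eq_bigr => k _; rewrite vE summxE scaler_suml.
  by apply: eq_bigr => j _; rewrite mxE scalerA.
rewrite {}lin mulmx_sumr raddf_sum /= mulr_sumr mxE; apply: eq_bigr => j _.
rewrite mxE mulr_suml -scalemxAr mxtraceZ curvature_suml.
rewrite mulmx_sumr raddf_sum /= !mulr_sumr; apply: eq_bigr => i _.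
by rewrite /star_ricci !mxE -scalemxAr mxtraceZ; ring.
Qed.

Lemma curvature_pullback f g p a u w : a != 0 ->
  diffeomorphism f -> riemannian_metric g ->
  curvature (fun q => a *: pullback_bilin f g q) p u w *m tangent_map f p =
  tangent_map f p *m
    curvature g (f p) (u *m tangent_map f p) (w *m tangent_map f p).
Proof.
move=> a0 df mg; have [h [fK _ sf sh]] := df.
have [smg _ _] := mg.
pose c := chart_at p; pose d := chart_at (f p); pose x := coord c p.
have ac : atlas c by exact: chart_at_atlas.
have ad : atlas d by exact: chart_at_atlas.
have cp : param c x = p by apply: coordK; exact: chart_at_source.
have Ux : rep_domain f c d x.
  split; first exact/coord_target/chart_at_source.
  by rewrite cp; exact: chart_at_source.
have Fx : local_rep f c d x = coord d (f p) by rewrite /local_rep cp.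
have UV y : rep_domain f c d y -> target d (local_rep f c d y).
  by move=> [_ dy]; exact: coord_target.
have H y := @bilin_in_scale_pullback _ _ _ f g c d y a sf ac ad.
have oU : open (rep_domain f c d) by apply: open_rep_domain; case: sf.
have rp i j := riemann_pullback oU (@target_open _ _ _ d) UV
  (Ck_local_rep 3 sf ac ad) (smg d ad 2)
  (fun y _ => bilin_in_sym d y mg) (fun y => bilin_in_unit mg ad)
  (fun y Uy => jacobian_local_rep_unit fK sf sh ac ad Uy) a0 H i j Ux.
rewrite Fx in rp; have C u' w' := curvatureE g (f p) u' w'.
rewrite [X in X *m _ = _]curvatureE [X in _ = _ *m X]C.
exact: conj_form_sum rp.
Qed.

Lemma star_ricci_pullback phi f g p a : a != 0 ->
  diffeomorphism f -> riemannian_metric g ->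
  star_ricci (pullback_endo f phi) (fun q => a *: pullback_bilin f g q) p
  = pullback_bilin f (star_ricci phi g) p.
Proof.
move=> a0 df mg; have uT := tangent_map_unit p df.
apply/matrixP => i j.
pose u : 'rV[R]_n := delta_mx 0 i; pose w : 'rV[R]_n := delta_mx 0 j.
have entry (B : 'M[R]_n) : B i j = (u *m B *m w^T) 0 0.
  by rewrite -rowE trmx_delta -colE !mxE.
rewrite [LHS]entry [RHS]entry star_ricciE.
have -> : u *m pullback_bilin f (star_ricci phi g) p *m w^T =
    (u *m tangent_map f p) *m star_ricci phi g (f p)
    *m (w *m tangent_map f p)^T.
  by rewrite trmx_mul !mulmxA.
rewrite star_ricciE; apply: (congr1 ( *%R 2^-1)).
have C := curvature_pullback p u (w *m pullback_endo f phi p) a0 df mg.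
(* Here the transport of phi is essential: the inverse tangent map inside [pullback_endo] cancels,
   leaving phi at f p in the second curvature slot. *)
have wT : w *m pullback_endo f phi p *m tangent_map f p
    = w *m tangent_map f p *m phi (f p).
  by rewrite /pullback_endo !mulmxA mulmxKV.
rewrite {}wT in C; move: C; set K := curvature _ p _ _; set K' := curvature _ _ _ _.
move=> KT; have -> : K = tangent_map f p *m K' *m invmx (tangent_map f p).
  by rewrite -KT mulmxK.
rewrite mulmxA mxtrace_mulC /pullback_endo !mulmxA mulVmx // mul1mx.
by rewrite mulmxKV.
Qed.

End Naturality.

(** * Evolution along a flow *)

Section Flow.
Context {R : realType} {n : nat} {M : manifold R n}.
Variables (J : set R) (X : R -> vector_field M) (psi : R -> M -> M).
Hypotheses (oJ : open J) (fl : flow_of J X psi).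
Implicit Types (c d : chart R n M) (p : M) (g : bilin_field M).

Definition flow_domain c d : set (R * 'rV[R]_n) :=
  [set tx | [/\ J tx.1, target c tx.2 & source d (psi tx.1 (param c tx.2))]].

Definition flow_rep c d (tx : R * 'rV[R]_n) : 'rV[R]_n :=
  coord d (psi tx.1 (param c tx.2)).

Lemma open_flow_domain c d : open (flow_domain c d).
Proof.
rewrite openE => -[t x] [/= Jt cx dx].
have nJ : nbhs t J by apply: open_nbhs_nbhs.
have nt : nbhs x (target c).
  by apply: open_nbhs_nbhs; split => //; exact: target_open.
have nd : nbhs (psi t (param c x)) (source d).
  by apply: open_nbhs_nbhs; split => //; exact: source_open.
have [_ _ [cpsi _] _] := fl.
have [[A B] [/= nA nB] AB] := cpsi t (param c x) Jt _ nd.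
have nB' := param_continuous cx nB.
exists (A `&` J, (param c @^-1` B) `&` target c).
  by split; apply: filterI.
by move=> [s y] [/= [As Js] [By cy]]; split => //; exact: (AB (s, param c y)).
Qed.

Lemma Ck_flow_rep c d k : atlas c -> atlas d ->
  Ck k (flow_domain c d) (flow_rep c d).
Proof. by move=> ac ad; have [_ _ [_ s] _] := fl; exact: s. Qed.

Lemma near_flow_domain c d t x : flow_domain c d (t, x) ->
  \forall s \near t, flow_domain c d (s, x).
Proof.
move=> D; have [[A B] [/= nA nB] AB] : nbhs (t, x) (flow_domain c d).
  by apply: open_nbhs_nbhs; split => //; exact: open_flow_domain.
apply: filterS nA => s As; apply: (AB (s, x)); split => //=.
exact: nbhs_singleton.
Qed.

(** [flow_of] gives the velocity only in the preferred chart at psi_t of the point. Near time t the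
    curve in d is its image under a fixed transition map, whose differential carries the velocity to
    the components in d. *)
Lemma flow_velocity c d t x : atlas c -> atlas d -> flow_domain c d (t, x) ->
  'D_(1, 0) (flow_rep c d) (t, x) = vector_in d (X t) (flow_rep c d (t, x)).
Proof.
move=> ac ad D; have [/= Jt cx dx] := D; have [_ _ _ dpsi] := fl.
pose q := psi t (param c x); pose e := chart_at q.
have eq : source e q by exact: chart_at_source.
have ae : atlas e by exact: chart_at_atlas.
have De : flow_domain c e (t, x) by [].
have sid := @smooth_map_id _ _ M.
have Uid : rep_domain id e d (coord e q).
  by split; [exact: coord_target|rewrite coordK].
have dF : is_derive t (1 : R) (fun s => flow_rep c e (s, x)) (X t q).
  exact: dpsi.
have dFd : differentiable (fun s : R => flow_rep c e (s, x)) t.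
  by apply/derivable1_diffP; case: dF.
have dT := differentiable_local_rep sid ae ad Uid.
rewrite -derive_slice1.
have -> : 'D_(1 : R) (fun s => flow_rep c d (s, x)) t =
    'D_(1 : R) (local_rep id e d \o fun s => flow_rep c e (s, x)) t.
  apply: near_eq_derive; apply: filterS (near_flow_domain De) => s [_ _ es].
  by rewrite /local_rep /flow_rep /= coordK.
rewrite [LHS](derive_comp _ dFd dT) (@derive_val _ _ _ _ _ _ _ dF).
rewrite -[LHS](mul_row_jacobian _ dT) /vector_in.
by rewrite /flow_rep /= coordK.
Qed.

Hypothesis sX : forall t, J t -> smooth_vector (X t).

Lemma jacobian_slice c d s x i j : atlas c -> atlas d -> flow_domain c d (s, x) ->
  'J (local_rep (psi s) c d) x i j =
  ('D_(0, delta_mx 0 i) (flow_rep c d) (s, x)) 0 j.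
Proof.
move=> ac ad [/= Js cx dx]; have [_ dpsi _ _] := fl.
have [h [_ _ sf _]] := dpsi s Js.
have dF : differentiable (local_rep (psi s) c d) x.
  by apply: differentiable_local_rep => //; split.
rewrite [LHS](jacobianE _ _ dF).
by rewrite -derive_slice2.
Qed.

Lemma is_derive_jacobian_flow c d t x : atlas c -> atlas d ->
  flow_domain c d (t, x) ->
  is_derive t (1 : R) (fun s => 'J (local_rep (psi s) c d) x)
    ('J (local_rep (psi t) c d) x
     *m 'J (vector_in d (X t)) (local_rep (psi t) c d x)).
Proof.
move=> ac ad D; have [/= Jt cx dx] := D; have [_ dpsi _ _] := fl.
have [h [_ _ sf _]] := dpsi t Jt.
have Ux : rep_domain (psi t) c d x by [].
have dF := differentiable_local_rep sf ac ad Ux.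
have dW : differentiable (vector_in d (X t)) (local_rep (psi t) c d x).
  by have [+ _] := sX Jt ad 1; apply; exact: coord_target.
have oD : open (flow_domain c d) by exact: open_flow_domain.
have cPhi := Ck_flow_rep 2 ac ad.
apply/is_derive_mxP => i j.
have [_ /(_ (0, delta_mx 0 i))[dDi _]] := cPhi.
have dij := (is_derive_mxP _ _ _ _).1 (is_derive_slice1 (dDi _ D)) 0 j.
apply: (@near_eq_is_derive _ _ _ _ _ _ _ _ _ (is_derive_eq dij _)).
  by apply: filterS (near_flow_domain D) => s Ds; exact/esym/jacobian_slice.
have C := @derive_comm R (R * 'rV[R]_n)%type _ _ _ _ _
  (0 : R, delta_mx 0 i : 'rV[R]_n) (1 : R, 0 : 'rV[R]_n) oD D cPhi.
rewrite C -derive_slice2.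
(* At the fixed time t the velocity equation holds for all y near x, so it may be differentiated in
   space. *)
have -> : 'D_(delta_mx 0 i) (fun y => 'D_(1, 0) (flow_rep c d) (t, y)) x =
    'D_(delta_mx 0 i) (vector_in d (X t) \o local_rep (psi t) c d) x.
  apply: near_eq_derive.
  apply: filterS (near_rep_domain sf Ux) => y [cy dy].
  exact: flow_velocity ac ad (And3 Jt cy dy).
have dWF := differentiable_comp dF dW.
have E := congr1 (fun A : 'M[R]_n => A i j) (jacobian_comp dF dW).
exact: etrans (esym (jacobianE _ _ dWF)) E.
Qed.

Lemma is_derive_pullback_flow g t p : smooth_bilin g -> J t ->
  is_derive t (1 : R) (fun s => pullback_bilin (psi s) g p)
    (pullback_bilin (psi t) (lie_derivative (X t) g) p).
Proof.
move=> sg Jt; have [_ dpsi _ _] := fl.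
pose c := chart_at p; pose q := psi t p; pose d := chart_at q; pose x := coord c p.
have ac : atlas c by exact: chart_at_atlas.
have ad : atlas d by exact: chart_at_atlas.
have cp : param c x = p by apply: coordK; exact: chart_at_source.
have dq : source d q by exact: chart_at_source.
have D : flow_domain c d (t, x).
  by split => //=; [exact/coord_target/chart_at_source|rewrite cp].
have Fx : local_rep (psi t) c d x = coord d q by rewrite /local_rep cp.
have isJ := is_derive_jacobian_flow ac ad D.
have isB : is_derive t (1 : R) (fun s => bilin_in d g (local_rep (psi s) c d x))
    ('D_(X t q) (bilin_in d g) (coord d q)).
  have [dPhi _] := Ck_flow_rep 1 ac ad.
  have dF := is_derive_slice1 (dPhi _ D).
  have dFd : differentiable (fun s : R => flow_rep c d (s, x)) t.
    by apply/derivable1_diffP; case: dF.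
  have dB : differentiable (bilin_in d g) (flow_rep c d (t, x)).
    by have [+ _] := sg d ad 1; apply; apply: coord_target; case: D.
  split; first exact/diff_derivable/(differentiable_comp dFd dB).
  rewrite [LHS](derive_comp _ dFd dB) (@derive_val _ _ _ _ _ _ _ dF).
  rewrite (flow_velocity ac ad D).
  have -> : flow_rep c d (t, x) = coord d q by exact: Fx.
  by rewrite vector_in_self.
have h := is_derive_mulmx (is_derive_mulmx isJ isB) (is_derive_trmx isJ).
(* For s near t the point psi_s(p) stays in the fixed chart d. The pullback, although defined
   through [chart_at (psi s p)], then equals an expression in c and d that depends differentiably on
   s. *)
have near_pull : \forall s \near t,
    'J (local_rep (psi s) c d) x *m bilin_in d g (local_rep (psi s) c d x)
      *m ('J (local_rep (psi s) c d) x)^T = pullback_bilin (psi s) g p.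
  apply: filterS (near_flow_domain D) => s [/= Js cx ds].
  have [h' [_ _ sf _]] := dpsi s Js.
  have E := @bilin_in_pullback _ _ _ _ g c d x sf ac ad (conj cx ds).
  by apply: etrans (esym E) _; exact: (bilin_in_self (pullback_bilin (psi s) g) p).
apply: (near_eq_is_derive near_pull); apply: (is_derive_eq h).
rewrite Fx; rewrite bilin_in_self /pullback_bilin.
have -> : tangent_map (psi t) p = 'J (local_rep (psi t) c d) x by [].
move: ('J (local_rep (psi t) c d) x) => A.
rewrite /lie_derivative -/q -/d.
move: ('D_(X t q) (bilin_in d g) (coord d q)) ('J (vector_in d (X t)) (coord d q)).
move=> B L; rewrite trmx_mul !(mulmxDl, mulmxDr) !mulmxA.
by congr (_ + _); rewrite addrC.
Qed.

End Flow.

(** * Scaling rules used with the soliton equation *)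

Section Soliton.
Context {R : realType} {n : nat} {M : manifold R n}.
Implicit Types (Y : vector_field M) (g : bilin_field M) (f : M -> M) (p : M).

Lemma vector_in_scale Y c a :
  vector_in c (fun p => a *: Y p) = fun x => a *: vector_in c Y x.
Proof. by apply/funext => x; rewrite /vector_in scalemxAl. Qed.

Lemma smooth_vector_scale Y a :
  smooth_vector Y -> smooth_vector (fun p => a *: Y p).
Proof.
move=> sY c ac k; rewrite vector_in_scale.
exact: Ck_scale (@target_open _ _ _ c) (sY c ac k).
Qed.

(** The factor is constant on M, as 1 / sigma(t) is at a fixed time, so no derivative of it
    appears. *)
Lemma lie_derivative_scale Y g a p : smooth_vector Y -> smooth_bilin g ->
  lie_derivative (fun p => a *: Y p) g p = a *: lie_derivative Y g p.
Proof.
move=> sY sg; rewrite /lie_derivative vector_in_scale.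
set c := chart_at p; set x := coord c p.
have ac : atlas c by exact: chart_at_atlas.
have cx : target c x by exact/coord_target/chart_at_source.
have dg : differentiable (bilin_in c g) x by have [+ _] := sg c ac 1; exact.
have dY : differentiable (vector_in c Y) x by have [+ _] := sY c ac 1; exact.
have -> : 'D_(a *: Y p) (bilin_in c g) x = a *: 'D_(Y p) (bilin_in c g) x.
  by rewrite !deriveE // linearZ.
have -> : 'J (fun x => a *: vector_in c Y x) x = a *: 'J (vector_in c Y) x.
  exact: jacobianZ.
by rewrite linearZ /= -scalemxAl -scalemxAr -!scalerDr.
Qed.

Lemma pullback_bilinD f g g' p :
  pullback_bilin f (fun q => g q + g' q) p
  = pullback_bilin f g p + pullback_bilin f g' p.
Proof. by rewrite /pullback_bilin mulmxDr mulmxDl. Qed.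

Lemma pullback_bilinZ f g a p :
  pullback_bilin f (fun q => a *: g q) p = a *: pullback_bilin f g p.
Proof. by rewrite /pullback_bilin -scalemxAr -scalemxAl. Qed.

Lemma pullback_bilin_id g : pullback_bilin id g = g.
Proof.
apply/funext => p; rewrite /pullback_bilin tangent_mapE.
rewrite (_ : 'J _ _ = 1%:M) ?trmx1 ?mulmx1 ?mul1mx //.
exact/jacobian_local_rep_id/coord_target/chart_at_source.
Qed.

Lemma is_derive_sigma (lambda t : R) :
  is_derive t (1 : R) (sigma lambda) (- (2 * lambda)).
Proof.
have h : is_derive t (1 : R) (cst 1 - (2 * lambda) \*: id) (0 - (2 * lambda) *: 1).
  exact: is_deriveB.
by apply: (is_derive_eq h); rewrite sub0r [_ *: _]mulr1.
Qed.

End Soliton.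

Unset Implicit Arguments.

Theorem mainTheorem1 (R : realType) (n : nat) (M : manifold R n)
    (phi : endo_field M) (xi : vector_field M) (eta : one_form M)
    (g0 : bilin_field M) (Y : vector_field M) (lambda : R)
    (J : set R) (psi : R -> M -> M) :
  almost_contact phi xi eta ->
  riemannian_metric g0 ->
  smooth_vector Y ->
  (forall p, - 2 *: star_ricci phi g0 p
             = lie_derivative Y g0 p - (2 * lambda) *: g0 p) ->
  open J -> is_interval J -> J 0 ->
  (forall t, J t -> 0 < sigma lambda t) ->
  let X := fun t p => (sigma lambda t)^-1 *: Y p in
  flow_of J X psi ->
  [/\ gbar lambda psi g0 0 = g0,
      forall t p, J t ->
      [/\ is_derive t 1 (fun s => gbar lambda psi g0 s p)
            (derive1 (sigma lambda) t *: pullback_bilin (psi t) g0 p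
             + sigma lambda t *:
               pullback_bilin (psi t) (lie_derivative (X t) g0) p),
          derive1 (sigma lambda) t *: pullback_bilin (psi t) g0 p
          + sigma lambda t *:
            pullback_bilin (psi t) (lie_derivative (X t) g0) p
          = pullback_bilin (psi t)
              (fun q => - (2 * lambda) *: g0 q + lie_derivative Y g0 q) p,
          pullback_bilin (psi t)
            (fun q => - (2 * lambda) *: g0 q + lie_derivative Y g0 q) p
          = pullback_bilin (psi t) (fun q => - 2 *: star_ricci phi g0 q) p
        & pullback_bilin (psi t) (fun q => - 2 *: star_ricci phi g0 q) p
          = - 2 *: star_ricci (pullback_endo (psi t) phi)
                              (gbar lambda psi g0 t) p],
      star_ricci_flow J (fun t => pullback_endo (psi t) phi)
                      (gbar lambda psi g0)
    & (forall t, J t -> pullback_endo (psi t) phi = phi) ->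
      star_ricci_flow J (fun=> phi) (gbar lambda psi g0)].
Proof.
move=> _ mg sY soliton oJ _ J0 sigma_gt0 X fl.
have [sg _ _] := mg; have [psi0 dpsi _ _] := fl.
have sX t : J t -> smooth_vector (X t) by move=> _; exact: smooth_vector_scale.
have s1 t : derive1 (sigma lambda) t = - (2 * lambda).
  by rewrite derive1E (@derive_val _ _ _ _ _ _ _ (is_derive_sigma lambda t)).
(* Nonvanishing serves to cancel sigma and to apply the scaling invariance; the positivity behind it
   keeps the metric gbar(t) positive definite. *)
have sn0 t : J t -> sigma lambda t != 0 by move=> /sigma_gt0 /lt0r_neq0.
have steps t p : J t ->
  [/\ is_derive t (1 : R) (fun s => gbar lambda psi g0 s p)
        (derive1 (sigma lambda) t *: pullback_bilin (psi t) g0 p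
         + sigma lambda t *:
           pullback_bilin (psi t) (lie_derivative (X t) g0) p),
      derive1 (sigma lambda) t *: pullback_bilin (psi t) g0 p
      + sigma lambda t *:
        pullback_bilin (psi t) (lie_derivative (X t) g0) p
      = pullback_bilin (psi t)
          (fun q => - (2 * lambda) *: g0 q + lie_derivative Y g0 q) p,
      pullback_bilin (psi t)
        (fun q => - (2 * lambda) *: g0 q + lie_derivative Y g0 q) p
      = pullback_bilin (psi t) (fun q => - 2 *: star_ricci phi g0 q) p
    & pullback_bilin (psi t) (fun q => - 2 *: star_ricci phi g0 q) p
      = - 2 *: star_ricci (pullback_endo (psi t) phi)
                          (gbar lambda psi g0 t) p].
  move=> Jt; rewrite s1; split.
  - exact: is_derive_scale (is_derive_sigma lambda t)
      (is_derive_pullback_flow oJ fl sX p sg Jt).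
  - apply: etrans (esym (pullback_bilinD _ _ _ _)).
    rewrite (pullback_bilinZ _ g0); congr (_ + _).
    have -> : lie_derivative (X t) g0 =
        fun q => (sigma lambda t)^-1 *: lie_derivative Y g0 q.
      by apply/funext => q; exact: lie_derivative_scale.
    rewrite (pullback_bilinZ _ (lie_derivative Y g0)) scalerA mulfV ?scale1r //.
    exact: sn0.
  - congr (pullback_bilin _ _ _); apply/funext => q.
    by rewrite soliton addrC scaleNr.
  - rewrite (pullback_bilinZ _ (star_ricci phi g0)); congr (_ *: _); apply/esym.
    exact: star_ricci_pullback (sn0 t Jt) (dpsi t Jt) mg.
have flow : star_ricci_flow J (fun t => pullback_endo (psi t) phi)
    (gbar lambda psi g0).
  move=> t Jt; split.
    exact: riemannian_metric_pullback (sigma_gt0 t Jt) (dpsi t Jt) mg.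
  move=> p; have [h e1 e2 e3] := steps t p Jt.
  exact: is_derive_eq h (etrans e1 (etrans e2 e3)).
split => //.
  apply/funext => p; rewrite /gbar /sigma mulr0 subr0 scale1r.
  by rewrite (funext psi0 : psi 0 = id) pullback_bilin_id.
(* The star-Ricci tensor at time t involves the structure tensor at that time only, so invariance of
   phi can be substituted separately for each t. *)
by move=> inv t Jt; rewrite -{1}(inv t Jt); exact: flow.
Qed.
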